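(* Let $\alpha>0$, let $r_n=e^{-n^\alpha}$ for $n\ge 1$, and let $S=\bigcap_{m=1}^\infty\bigcup_{n=m}^\infty V_n$ be the corresponding uniform $G_\delta$-set. Then: (1) if $\alpha>2$, then $\mathrm{Cap}(S)=0$; (2) if $\alpha<2$, then $\mathrm{Cap}(S)=\mathrm{Cap}([0,1])$.
   Context: For a compactly supported Borel measure $\mu$ on $\mathbb{C}$, its energy is $I(\mu):=\iint -\log|z-w|\,d\mu(z)\,d\mu(w)$ (possibly $+\infty$). For a bounded Borel set $X\subset\mathbb{C}$, let $\mathcal{P}(X)$ be the set of Borel probability measures supported on $X$ (i.e. $\mu(\mathbb{C}\setminus X)=0$); the logarithmic capacity of $X$ is $\mathrm{Cap}(X):=\exp(-\inf\{I(\mu)\mid \mu\in\mathcal{P}(X)\})$, with $\exp(-\infty)=0$. For the sequence $(r_n)$ set $c_{j,n}=\frac{2j+1}{2n}$, $J_{j,n}=(c_{j,n}-\frac{r_n}{2},\,c_{j,n}+\frac{r_n}{2})$ for $j=0,\dots,n-1$, and $V_n=\bigcup_{j=0}^{n-1}J_{j,n}$. The uniform $G_\delta$-set corresponding to $(r_n)$ is $S:=\bigcap_{m=1}^\infty\bigcup_{n=m}^\infty V_n$. *)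

(* Defs.v *)
From mathcomp Require Import all_boot all_order all_algebra.
From mathcomp Require Import all_classical all_reals all_analysis.
From mathcomp Require Import complex.

Set Implicit Arguments.
Unset Strict Implicit.
Unset Printing Implicit Defensive.

Import Order.TTheory GRing.Theory Num.Theory.
Import numFieldNormedType.Exports.

Local Open Scope classical_set_scope.
Local Open Scope ring_scope.
Local Open Scope complex_scope.

(* The complex plane with its Borel sigma-algebra.  The library puts no
   topology on [R[i]] itself; [R[i]^o] is the same type with the topology of
   the modulus. *)
Definition borelC (R : realType) := g_sigma_algebraType (@open R[i]^o).

Section Capacity.
Context {R : realType}.

(* [lne 0 = -oo], so the kernel is [+oo] on the diagonal. *)
Definition log_kernel (z w : R[i]) : \bar R :=
  (- lne (complex.Re `|z - w|)%:E)%E.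

(* For [mu] carried by a bounded set the kernel is bounded below almost
   everywhere, so the iterated integral is the integral against [mu \x mu]. *)
Definition energy (mu : probability (borelC R) R) : \bar R :=
  (\int[mu]_z \int[mu]_w log_kernel z w)%E.

(* Measures are total on sets in the library and unconstrained off the
   sigma-algebra, so this is meaningful for Borel [X] only. *)
Definition probs_on (X : set R[i]) : set (probability (borelC R) R) :=
  [set mu | mu (~` X) = 0%E].

(* [expeR -oo = 0].  For empty [X] the infimum is [+oo] and the capacity 0. *)
Definition Cap (X : set R[i]) : \bar R :=
  expeR (- ereal_inf [set energy mu | mu in probs_on X])%E.

Definition midpt (j n : nat) : R := (2 * j + 1)%N%:R / (2 * n)%N%:R.

Definition J (r : nat -> R) (j n : nat) : set R :=
  `]midpt j n - r n / 2, midpt j n + r n / 2[.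

Definition V (r : nat -> R) (n : nat) : set R := \bigcup_(j < n) J r j n.

Definition uniform_Gdelta (r : nat -> R) : set R :=
  \bigcap_(m in [set m | (1 <= m)%N]) \bigcup_(n in [set n | (m <= n)%N]) V r n.

Definition in_plane (A : set R) : set R[i] := [set x%:C | x in A].

End Capacity.

(* Main.v *)
From HB Require Import structures.
Require Import Defs.
From mathcomp Require Import all_boot all_order all_algebra.
From mathcomp Require Import all_classical all_reals all_analysis measurable_realfun.
From mathcomp Require Import complex ring lra zify.

(** Everything happens for measures on the line. A measure carried by a subset
of [[0, 1]] of the plane is the image of a measure on the real line, and
distances in [[0, 1]] are at most [1], so the kernel may be replaced by its
nonnegative part [log_gauge] ([energies_in_plane]).

When [alpha > 2], suppose that [nu] lives on [S] and has finite energy. Its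
potential [U x = \int -log|x-y| dnu(y)] is then finite almost everywhere, so it
is enough that [S] meets every set [[U <= M]] in a null set. If [U <= M] at some
point of an interval [J j n], of length [e^(-n^alpha)], the whole interval is
within that distance of the point, so its mass is at most [M n^(-alpha)]; the
[n] intervals of [V n] that meet [[U <= M]] have total mass at most
[M n^(1-alpha)] ([low_V]). This is summable precisely because [alpha > 2], and
the Borel-Cantelli lemma concludes ([low_Gdelta]).

When [alpha < 2], any [nu] on [[0, 1]] of finite energy [I] is replaced by a
measure on [S] of energy at most [I + eps] ([energy_approximation]). Work with
configurations: finite lists of cells [[a/L, (a+1)/L]] of a grid, the energy
being the average over pairs of cells of [ln (L / max(1, |a - a'|))]. Rounding
[nu] to the grid of mesh [1/L] gives a configuration of energy [E] with [E + 1]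
about [I + 1] ([initial_config]). A configuration is then refined for ever: each
cell [a] is replaced by the [N^2] tiny cells starting at [(a + (2j+1)/(4p))/L]
for [N <= p < 2N] and [j < N]. These points are midpoints [midpt (2pa+j) (2pL)],
so a tiny cell of mesh [1/(Lq)], with [q > 2 exp((4LN)^alpha)], lies inside an
interval of [V (2pL)] ([refinement]). A point surviving all refinements is
therefore in [S] ([limit_measure]).

The heart of the matter is that a refinement costs almost no energy, namely
[E' + 1 <= (1 + 25/(1 + ln L)) (E + 1)] ([refined_energy]). Pairs of tiny cells
with different parents are at about the distance of their parents ([cost_far]).
For two points with the same parent one needs the energy of the fractions
[(2j+1)/(4p)] among themselves ([local_energy]). Two of them differ by
[((2j+1)r - (2l+1)p)/(4pr)]; if [p], [j], [r] are fixed these differences are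
[1/(2r)]-separated in [l], so that all but one value of [l] contribute a bounded
average ([cost_row]), and the remaining one is harmless unless the fractions
coincide, in which case it costs the full [ln q]. A coincidence forces
[p %| (2j+1) r], and a sum of gcds shows that there are only [O(N^2 log N)] of
them among [N^4] pairs ([coincidences]). They contribute [O(log N * ln q / N^2)]
where [ln q] is about [(4LN)^alpha + N log N]: this is bounded, for [N] large,
because [alpha < 2] ([choose_parameters]).

The factors [1 + 25/(1 + ln L)] have a product close to [1] along the sequence
of refinements, since the scales can be made to grow doubly exponentially
([refining_sequence]). Choosing cells by the digits of a uniform random number
turns the nested configurations into a random point of [S], whose law has energy
at most the supremum of the configuration energies. *)

Import Order.TTheory GRing.Theory Num.Theory.
Import numFieldNormedType.Exports.

Local Open Scope classical_set_scope.
Local Open Scope ring_scope.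

(** * From the plane to the line *)

(** Tonelli gives this for functions of constant sign only; the logarithmic
kernel of the plane takes both signs, hence the splitting. *)
Lemma measurable_fun_integral_pair {d1 d2} {T1 : measurableType d1} {T2 : measurableType d2}
    {R : realType} (m : {sigma_finite_measure set T2 -> \bar R}) (f : T1 * T2 -> \bar R) :
  measurable_fun setT f -> measurable_fun setT (fun x => \int[m]_y f (x, y))%E.
Proof.
move=> mf.
have -> : (fun x => \int[m]_y f (x, y))%E =
    ((fun x => \int[m]_y f^\+ (x, y)) \- (fun x => \int[m]_y f^\- (x, y)))%E.
  apply/funext => x; rewrite integralE.
  by congr (_ - _)%E; apply: eq_integral => y _; rewrite unlock.
apply: emeasurable_funB.
- apply: (measurable_fun_fubini_tonelli_F (f^\+)%E) => //.
  exact: measurable_funepos.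
- apply: (measurable_fun_fubini_tonelli_F (f^\-)%E) => //.
  exact: measurable_funeneg.
Qed.

Lemma measurable_fun_section {d1 d2 d3} {T1 : measurableType d1} {T2 : measurableType d2}
    {T3 : measurableType d3} (f : T1 * T2 -> T3) (x : T1) :
  measurable_fun setT f -> measurable_fun setT (fun y => f (x, y)).
Proof. by move=> mf; apply: (measurableT_comp mf); exact: measurable_pair1. Qed.

Section Transfer.
Context {R : realType}.
Implicit Types (nu : probability R R).

(** Cutting the kernel at [0] makes every integral below one of a nonnegative
function, so that Tonelli and monotone convergence apply without integrability
conditions; on distances at most [1] nothing is lost. *)
Definition log_gauge (d : R) : \bar R := maxe 0%E (- lne d%:E)%E.

Definition real_energy nu : \bar R :=
  (\int[nu]_x \int[nu]_y log_gauge (`|x - y|)%R)%E.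

Lemma measurable_lne_EFin : measurable_fun setT (fun d : R => lne d%:E).
Proof.
rewrite /lne /=; apply: measurable_fun_if => //.
- exact: measurable_fun_ler.
- by apply: measurableT_comp => //; apply: measurable_funTS; exact: measurable_ln.
Qed.

Lemma measurable_log_gauge : measurable_fun setT log_gauge.
Proof.
apply: measurable_maxe => //.
by apply: measurableT_comp => //; exact: measurable_lne_EFin.
Qed.

Lemma log_gauge_ge0 d : (0 <= log_gauge d)%E.
Proof. by rewrite le_max lexx. Qed.

Lemma log_gaugeE (d : R) : d <= 1 -> log_gauge d = (- lne d%:E)%E.
Proof. by move=> d1; apply/max_idPr; rewrite oppe_ge0 lne_le0 lee_fin. Qed.

(** The projection and the embedding [to_plane] below get names so that they can
carry the structure of a measurable function, which image measures require. *)
Definition real_part : borelC R -> R := @complex.Re R.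

(** The Borel sigma-algebra of the plane is generated by the topology of the
modulus, so it is openness of a vertical strip that has to be shown. *)
Lemma measurable_Re : measurable_fun setT real_part.
Proof.
apply: (measurability _ (RGenOpens.measurableE R)) => _ [_ [a [b ->]] <-].
rewrite setTI; apply: sub_sigma_algebra => /=.
rewrite openE => z /=; rewrite in_itv /= => /andP[az zb].
apply/nbhs_ballP; exists (Num.min (complex.Re z - a) (b - complex.Re z))%:C%C.
  by rewrite /= ltcE /= eqxx lt_min !subr_gt0 az zb.
move=> w; rewrite -ball_normE /ball_ /= => zw.
have : (`|complex.Re (z - w)|%:C < (Num.min (complex.Re z - a) (b - complex.Re z))%:C)%C.
  exact: le_lt_trans (normc_ge_Re _) zw.
rewrite ltcE /= eqxx /= lt_min => /andP[].
rewrite in_itv /=; case: (z) (w) => [x y] [x' y'] /=.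
by rewrite !ltr_norml => /andP[? ?] /andP[? ?]; apply/andP; split; lra.
Qed.

Lemma measurable_Im : measurable_fun setT (@complex.Im R : borelC R -> R).
Proof.
apply: (measurability _ (RGenOpens.measurableE R)) => _ [_ [a [b ->]] <-].
rewrite setTI; apply: sub_sigma_algebra => /=.
rewrite openE => z /=; rewrite in_itv /= => /andP[az zb].
apply/nbhs_ballP; exists (Num.min (complex.Im z - a) (b - complex.Im z))%:C%C.
  by rewrite /= ltcE /= eqxx lt_min !subr_gt0 az zb.
move=> w; rewrite -ball_normE /ball_ /= => zw.
have : (`|complex.Im (z - w)|%:C < (Num.min (complex.Im z - a) (b - complex.Im z))%:C)%C.
  have -> : `|complex.Im (z - w)| = `|complex.Re ((z - w) * 'i%C)|.
    by rewrite ReiNIm normrN.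
  apply: le_lt_trans (normc_ge_Re _) _.
  by rewrite normrM [X in _ * X]normc_def /= expr0n expr1n add0r sqrtr1 mulr1.
rewrite ltcE /= eqxx /= lt_min => /andP[].
rewrite in_itv /=; case: (z) (w) => [x y] [x' y'] /=.
by rewrite !ltr_norml => /andP[? ?] /andP[? ?]; apply/andP; split; lra.
Qed.

Definition to_plane (x : R) : borelC R := x%:C%C.

Lemma measurable_to_plane : measurable_fun setT to_plane.
Proof.
apply: (@measurability _ _ _ (borelC R) _ _ (@open R[i]^o) erefl) => _ [U oU <-].
rewrite setTI; apply: open_measurable; rewrite openE => x /= Ux.
move: oU; rewrite openE => /(_ _ Ux) /nbhs_ballP[e /= e0 eU].
apply/nbhs_ballP; exists (complex.Re e) => /=.
  by move: e0; rewrite ltcE => /andP[].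
move=> y; rewrite -ball_normE /= => xy; apply: eU.
rewrite -ball_normE /= -rmorphB /= normc_def /= expr0n addr0 sqrtr_sqr.
by move: e0; rewrite !ltcE /= xy => /andP[-> ].
Qed.

Lemma measurable_in_plane (X : set R) :
  measurable X -> (measurable (in_plane X : set (borelC R))).
Proof.
move=> mX.
have -> : in_plane X = (@complex.Re R @^-1` X) `&` (@complex.Im R @^-1` [set 0]).
  apply/seteqP; split => [z [x Xx <-] //|[x y] /= [Xx ->]].
  by exists x.
apply: (@measurableI _ (borelC R)).
  by rewrite -[X in measurable X]setTI; apply: measurable_Re.
by rewrite -[X in measurable X]setTI; apply: measurable_Im.
Qed.

Lemma measurable_cdist : measurable_fun setT
  (fun p : borelC R * borelC R => complex.Re (`|p.1 - p.2| : R[i])).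
Proof.
have -> : (fun p : borelC R * borelC R => complex.Re (`|p.1 - p.2| : R[i])) =
  (fun p : borelC R * borelC R => Num.sqrt
    ((complex.Re p.1 - complex.Re p.2) ^+ 2 + (complex.Im p.1 - complex.Im p.2) ^+ 2)).
  by apply/funext => -[[a b] [c d]].
apply: (@measurableT_comp _ _ _ _ _ _ (@Num.sqrt R)).
  by apply: continuous_measurable_fun => x; exact: sqrt_continuous.
apply: measurable_funD; apply: measurable_funX; apply: measurable_funB.
- by apply: (measurableT_comp measurable_Re); exact: measurable_fst.
- by apply: (measurableT_comp measurable_Re); exact: measurable_snd.
- by apply: (measurableT_comp measurable_Im); exact: measurable_fst.
- by apply: (measurableT_comp measurable_Im); exact: measurable_snd.
Qed.

Lemma measurable_log_kernel : measurable_fun setT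
  (fun p : borelC R * borelC R => log_kernel p.1 p.2).
Proof.
apply: measurableT_comp => //.
by apply: (measurableT_comp measurable_lne_EFin); exact: measurable_cdist.
Qed.

Lemma measurable_log_gauge_dist : measurable_fun setT
  (fun p : R * R => log_gauge `|p.1 - p.2|).
Proof.
apply: (measurableT_comp measurable_log_gauge); apply: measurableT_comp => //.
by apply: measurable_funB; [exact: measurable_fst|exact: measurable_snd].
Qed.

Lemma measurable_potential nu :
  measurable_fun setT (fun x : R => (\int[nu]_y log_gauge (`|x - y|)%R)%E).
Proof.
apply: (measurable_fun_fubini_tonelli_F _ measurable_log_gauge_dist).
by move=> p; exact: log_gauge_ge0.
Qed.

HB.instance Definition _ := isMeasurableFun.Build _ _ _ _ _ measurable_Re.
HB.instance Definition _ := isMeasurableFun.Build _ _ _ _ _ measurable_to_plane.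

Definition real_law (mu : probability (borelC R) R) : probability R R :=
  distribution mu (real_part : {mfun borelC R >-> R}).
Definition plane_law (nu : probability R R) : probability (borelC R) R :=
  distribution nu (to_plane : {mfun R >-> borelC R}).

Section RealLaw.
Variables (mu : probability (borelC R) R) (X : set R).
Hypotheses (mX : measurable X) (X01 : X `<=` `[0, 1]%classic) (muX : mu (~` in_plane X) = 0%E).

Let N : set (borelC R) := ~` in_plane X.

Let mN : measurable N.
Proof. by apply: measurableC; exact: measurable_in_plane. Qed.

Let ae_in_plane (f g : borelC R -> \bar R) :
  (forall z, in_plane X z -> f z = g z) -> ae_eq mu setT f g.
Proof.
move=> fg; exists N; split => // z /= /not_implyP[_ fgz] Xz.
exact: fgz (fg _ Xz).
Qed.

Let k_real (x y : R) : X x -> X y ->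
  log_kernel x%:C%C y%:C%C = log_gauge `|x - y|.
Proof.
move=> /X01 /=; rewrite in_itv /= => /andP[x0 x1] /X01 /=; rewrite in_itv /= => /andP[y0 y1].
rewrite log_gaugeE; last by rewrite ler_norml; lra.
by rewrite /log_kernel -rmorphB normc_def /= expr0n addr0 sqrtr_sqr.
Qed.

(** The two kernels agree on [[0, 1]] only, so both the inner and the outer
integral are compared almost everywhere, outside the null set [N]. *)
Lemma energy_real_law : energy mu = real_energy (real_law mu).
Proof.
rewrite /real_energy /real_law ge0_integral_distribution; last 2 first.
- exact: measurable_potential.
- by move=> x; apply: integral_ge0 => y _; exact: log_gauge_ge0.
apply: ae_eq_integral => //.
- exact: (@measurable_fun_integral_pair _ _ (borelC R) (borelC R) R mu
    (fun p => log_kernel p.1 p.2) measurable_log_kernel).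
- by apply: measurableT_comp; [exact: measurable_potential|exact: measurable_Re].
apply: ae_in_plane => _ [x Xx <-] /=.
rewrite ge0_integral_distribution; last 2 first.
- apply: (measurableT_comp measurable_log_gauge).
  apply: measurableT_comp => //; exact: measurable_funB.
- by move=> y; exact: log_gauge_ge0.
apply: ae_eq_integral => //.
- exact: (@measurable_fun_section _ _ _ (borelC R) (borelC R) _
    (fun p => log_kernel p.1 p.2) x%:C%C measurable_log_kernel).
- apply: (measurableT_comp measurable_log_gauge).
  apply: measurableT_comp => //; apply: measurable_funB => //; exact: measurable_Re.
by apply: ae_in_plane => _ [y Xy <-] /=; exact: k_real.
Qed.

Lemma real_law_supp : real_law mu (~` X) = 0%E.
Proof.
rewrite /real_law /distribution /pushforward /=.
apply: (@subset_measure0 _ _ _ mu _ N) => //.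
- by rewrite -[X in measurable X]setTI; apply: measurable_Re => //; exact: measurableC.
- by move=> z /= nXz [x Xx xz]; apply: nXz; rewrite -xz.
Qed.
End RealLaw.

Lemma plane_law_supp (nu : probability R R) (X : set R) :
  nu (~` X) = 0%E -> plane_law nu (~` in_plane X) = 0%E.
Proof.
rewrite /plane_law /distribution /pushforward /= => <-; congr (nu _).
apply/seteqP; split => x /=; first by move=> + Xx; apply; exists x.
by move=> nXx [y Xy [yx]]; apply: nXx; rewrite -yx.
Qed.

Lemma energy_plane_law (nu : probability R R) (X : set R) :
  measurable X -> X `<=` `[0, 1]%classic -> nu (~` X) = 0%E ->
  energy (plane_law nu) = real_energy nu.
Proof.
move=> mX X01 nuX.
rewrite (energy_real_law _ _ mX X01); last exact: plane_law_supp.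
by [].
Qed.

Definition carried_by (X : set R) : set (probability R R) := [set nu | nu (~` X) = 0%E].

(** The real part and the embedding carry measures back and forth without
changing energies; this reduces both capacities to infima over the line. *)
Lemma energies_in_plane (X : set R) : measurable X -> X `<=` `[0, 1]%classic ->
  [set energy mu | mu in probs_on (in_plane X)] =
  [set real_energy nu | nu in carried_by X].
Proof.
move=> mX X01; apply/seteqP; split => [_ [mu muX <-]|_ [nu nuX <-]].
  exists (real_law mu); first exact: real_law_supp.
  by rewrite -(energy_real_law _ _ mX X01).
exists (plane_law nu); first exact: plane_law_supp.
exact: energy_plane_law mX X01 nuX.
Qed.

End Transfer.

(** * Rapidly shrinking intervals: every energy is infinite *)

Section RiemannSeries.
Context {R : realType}.

(** Convexity of [x^(-b)]: the discrete form of comparing [x^(-1-b)] with the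
derivative of [-x^(-b) / b]. *)
Lemma powR_telescope (b : R) (n : nat) : 0 < b -> (0 < n)%N ->
  n.+1%:R `^ (- (1 + b)) <= b^-1 * (n%:R `^ (- b) - n.+1%:R `^ (- b)).
Proof.
move=> b0 n0; set x : R := n.+1%:R; set y : R := n%:R.
have y0 : 0 < y by rewrite ltr0n.
have x0 : 0 < x by rewrite ltr0n.
have yx : y = x * (1 - x^-1).
  by rewrite mulrBr mulr1 divff ?gt_eqF// /x /y -natr1 addrK.
have x1 : 0 < 1 - x^-1 by rewrite -(pmulr_rgt0 _ x0) -yx.
rewrite ler_pdivlMl // opprD powRD; last by rewrite (gt_eqF x0) implybT.
rewrite powR_inv1 ?(ltW x0) //.
have -> : y `^ (- b) = x `^ (- b) * (1 - x^-1) `^ (- b).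
  by rewrite yx powRM ?ltW.
have H : 1 + b * x^-1 <= (1 - x^-1) `^ (- b).
  rewrite /powR gt_eqF //; apply: le_trans (expR_ge1Dx _) _.
  rewrite ler_expR mulNr -mulrN ler_pM2l // lerNr.
  by apply: le_trans (le_ln1Dx _) _; rewrite ?ltrN2 // invf_lt1 // ltr1n.
have := ler_wpM2l (powR_ge0 x (- b)) H.
rewrite mulrDr mulr1 lerBrDl => h; apply: le_trans h; rewrite lerD2l.
by rewrite mulrA [leLHS]mulrC.
Qed.

Lemma sum_powR_le (b : R) (n : nat) : 0 < b ->
  \sum_(1 <= i < n.+1) i%:R `^ (- (1 + b)) <= 1 + b^-1.
Proof.
move=> b0.
suff : (0 < n)%N -> \sum_(1 <= i < n.+1) (i%:R : R) `^ (- (1 + b)) <= 1 + b^-1 * (1 - n%:R `^ (- b)).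
  case: n => [_|n /(_ isT) /le_trans]; first by rewrite big_geq // addr_ge0 // invr_ge0 ltW.
  apply; rewrite lerD2l ler_piMr ?invr_ge0 ?(ltW b0) //.
elim: n => // -[_ _|n IH _].
  by rewrite big_nat1 !powR1 subrr mulr0 addr0.
rewrite big_nat_recr //=; apply: le_trans (lerD (IH isT) (powR_telescope b n.+1 b0 isT)) _.
by rewrite -addrA -mulrDr subrKA.
Qed.
End RiemannSeries.

Section Gdelta.
Context {R : realType} (alpha : R).
Local Notation r := (fun n : nat => expR (- (n%:R `^ alpha)) : R).
Local Notation S := (uniform_Gdelta r).

Lemma measurable_J (u : nat -> R) j n : measurable (J u j n).
Proof. exact: measurable_itv. Qed.

Lemma measurable_V (u : nat -> R) n : measurable (V u n).
Proof. by apply: bigcup_measurable => j _; exact: measurable_J. Qed.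

Lemma measurable_uniform_Gdelta (u : nat -> R) : measurable (uniform_Gdelta u).
Proof.
apply: bigcap_measurable; first by exists 1%N => /=.
by move=> m _; apply: bigcup_measurable => n _; exact: measurable_V.
Qed.

Lemma in_uniform_Gdelta (u : nat -> R) (x : R) :
  uniform_Gdelta u x <-> forall m, exists2 n, (m <= n)%N & V u n x.
Proof.
split=> [Sx m|H m /= m1].
  have [n /= mn Vx] := Sx m.+1 isT.
  by exists n => //; exact: ltnW.
by have [n mn Vx] := H m; exists n.
Qed.

(** Radii below [1/n] keep every interval [J j n] inside [[0, 1]]. *)
Lemma radius_small (a : R) : 0 < a ->
  exists m : nat, (0 < m)%N /\ forall n, (m <= n)%N -> expR (- (n%:R `^ a)) <= n%:R^-1 :> R.
Proof.
move=> a0; pose c := 2 / a; have c0 : 0 < c by rewrite divr_gt0.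
(* For n >= c^c the square root y of n^a is at least c = 2/a, and then
   n^a = y * y >= c * ln y = ln n. *)
pose m := (Num.truncn (c `^ c)).+1; exists m; split=> // n mn.
have n0 : 0 < n%:R :> R by rewrite ltr0n (leq_trans _ mn).
set y := n%:R `^ (a / 2) : R.
have cy : c <= y.
  have -> : c = (c `^ c) `^ (a / 2).
    rewrite -powRrM (_ : c * (a / 2) = 1) ?powRr1 ?ltW //.
    by rewrite /c; field; rewrite gt_eqF.
  apply: ge0_ler_powR; rewrite ?nnegrE ?powR_ge0 ?divr_ge0 ?ltW //.
  by apply: lt_le_trans (truncnS_gt _) _; rewrite ler_nat.
have y0 : 0 < y by exact: lt_le_trans cy.
rewrite -[leRHS]lnK ?posrE ?invr_gt0 // ler_expR lnV ?posrE // lerN2.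
have -> : n%:R `^ a = y * y.
  by rewrite /y -powRD ?(gt_eqF n0) ?implybT //; congr (_ `^ _); lra.
have -> : ln n%:R = c * ln y.
  by rewrite /y ln_powR /c; field; rewrite gt_eqF.
apply: ler_pM => //; rewrite ?(ltW c0) //.
  by rewrite /y ln_powR mulr_ge0 ?divr_ge0 ?(ltW a0) // ln_ge0 // ler1n (leq_trans _ mn).
by rewrite ltW // ln_sublinear.
Qed.

(** The finitely many sets [V n] with a large radius may leave [[0, 1]], but
points of [S] also lie in [V n] for some large [n]. *)
Lemma uniform_Gdelta_sub01 : 0 < alpha -> S `<=` `[0, 1]%classic.
Proof.
move=> a0 x /in_uniform_Gdelta Sx.
have [m [m0 Hm]] := radius_small _ a0.
have [n mn [j /= jn]] := Sx m.
have n0 : (0 < n)%N by exact: leq_trans mn.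
have {}Hm := Hm n mn.
rewrite /J /= !in_itv /= /midpt => /andP[lo hi].
have n0' : 0 < (n%:R : R) by rewrite ltr0n.
have E : (2 * j + 1)%N%:R / (2 * n)%N%:R = (j%:R + 2^-1) / n%:R :> R.
  by rewrite natrD !natrM; field; rewrite pnatr_eq0 -lt0n.
have j0 : 0 <= (j%:R : R) by rewrite ler0n.
have jn' : j%:R + 1 <= n%:R :> R by rewrite natr1 ler_nat.
rewrite E in lo hi.
have E1 : (j%:R + 2^-1) / n%:R - n%:R^-1 / 2 = j%:R / n%:R :> R.
  by field; rewrite gt_eqF.
have E2 : (j%:R + 2^-1) / n%:R + n%:R^-1 / 2 = (j%:R + 1) / n%:R :> R.
  by field; rewrite gt_eqF.
have : 0 <= j%:R / n%:R :> R by rewrite divr_ge0 // ltW.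
have : (j%:R + 1) / n%:R <= 1 :> R by rewrite ler_pdivrMr // mul1r.
by rewrite -E1 -E2; lra.
Qed.

Lemma log_gauge_lb (L d : R) : 0 <= d -> d <= expR (- L) -> (L%:E <= log_gauge d)%E.
Proof.
move=> d0 dL; rewrite /log_gauge le_max; apply/orP; right.
rewrite leeNr -EFinN /lne; case: ifPn => [_|]; first exact: leNye.
by rewrite -ltNge lee_fin => d0'; rewrite -ler_expR lnK.
Qed.

Lemma potential_lb (nu : probability R R) (A : set R) (L x : R) : 0 <= L -> measurable A ->
  (forall y, A y -> `|x - y| <= expR (- L)) ->
  (L%:E * nu A <= \int[nu]_y log_gauge (`|x - y|)%R)%E.
Proof.
move=> L0 mA AL; rewrite -integral_cst //.
have mf : measurable_fun setT (fun y : R => log_gauge (`|x - y|)%R).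
  exact: (measurable_fun_section (fun p : R * R => log_gauge (`|p.1 - p.2|)%R) x measurable_log_gauge_dist).
apply: (@le_trans _ _ (\int[nu]_(y in A) log_gauge (`|x - y|)%R)%E).
  apply: ge0_le_integral => //; first exact: measurable_funTS.
  by move=> y Ay; apply: log_gauge_lb (AL _ Ay).
by apply: ge0_subset_integral => // y _; exact: log_gauge_ge0.
Qed.

End Gdelta.

Section ThinGdelta.
Context {R : realType} (alpha : R).
Local Notation r := (fun n : nat => expR (- (n%:R `^ alpha)) : R).
Local Notation S := (uniform_Gdelta r).
Variable nu : probability R R.
Let U (x : R) := (\int[nu]_y log_gauge (`|x - y|)%R)%E.

Let U_ge0 x : (0 <= U x)%E.
Proof. by apply: integral_ge0 => y _; exact: log_gauge_ge0. Qed.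

Let low (M : R) := [set x | (U x <= M%:E)%E].

Let measurable_low M : measurable (low M).
Proof.
rewrite -[low M]setTI; apply: emeasurable_fun_infty_c => //.
exact: measurable_potential.
Qed.

(** Each of the [n] intervals that contains a point of potential at most [M] has
mass at most [M / n^alpha], by [potential_lb] applied at that point. *)
Lemma low_V (M : R) (n : nat) : 0 <= M -> (0 < n)%N ->
  (nu (low M `&` V r n) <= (M * n%:R `^ (1 - alpha))%:E)%E.
Proof.
move=> M0 n0.
have n0' : 0 < n%:R :> R by rewrite ltr0n.
have na0 : 0 < (n%:R `^ alpha : R) by rewrite powR_gt0.
have HJ j : (nu (low M `&` J r j n) <= (M / n%:R `^ alpha)%:E)%E.
  have [->|/set0P[x [/= Ux Jx]]] := eqVneq (low M `&` J r j n) set0.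
    by rewrite measure0 lee_fin divr_ge0 // ltW.
  apply: (@le_trans _ _ (nu (J r j n))).
    apply: le_measure => [||y []//]; rewrite inE; last exact: measurable_J.
    by apply: measurableI => //; exact: measurable_J.
  rewrite EFinM lee_pdivlMr //.
  apply: le_trans Ux; rewrite muleC; apply: potential_lb => //.
    exact: measurable_J.
  move=> y; move: Jx; rewrite /J /= !in_itv /= => /andP[? ?] /andP[? ?].
  by rewrite ler_norml; apply/andP; split; lra.
have -> : low M `&` V r n = \big[setU/set0]_(j < n) (low M `&` J r j n).
  by rewrite -(bigcup_mkord n (fun j => low M `&` J r j n)) setI_bigcupr.
apply: (@le_trans _ _ (\sum_(j < n) nu (low M `&` J r j n))%E).
  apply: (@Boole_inequality _ _ _ nu (fun j => low M `&` J r j n)).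
  by move=> j _; apply: measurableI => //; exact: measurable_J.
apply: (@le_trans _ _ (\sum_(j < n) (M / n%:R `^ alpha)%:E)%E).
  by apply: lee_sum => j _; exact: HJ.
rewrite sumEFin lee_fin sumr_const card_ord powRB ?(gt_eqF n0') ?implybT // powRr1 ?(ltW n0') //.
by rewrite -[leLHS]mulr_natr -mulrA [n%:R / _]mulrC.
Qed.

(** Borel-Cantelli: the bounds of [low_V] are summable as [alpha - 1 > 1]. *)
Lemma low_Gdelta (M : R) : 2 < alpha -> 0 <= M -> nu (low M `&` S) = 0%E.
Proof.
move=> a2 M0; pose F n := low M `&` (if (0 < n)%N then V r n else set0).
have mF n : measurable (F n).
  by apply: measurableI => //; case: ifP => // _; exact: measurable_V.
apply: (@subset_measure0 _ _ _ nu _ (lim_sup_set F)) => //.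
- by apply: measurableI => //; exact: measurable_uniform_Gdelta.
- by apply: bigcap_measurable => // n _; apply: bigcup_measurable.
- move=> x [/= lx /in_uniform_Gdelta Sx] m _.
  have [n mn Vx] := Sx m.+1; exists n => /=; first exact: ltnW.
  by split=> //; rewrite (leq_trans _ mn).
apply: lim_sup_set_cvg0 => //.
have b0 : 0 < alpha - 2 by rewrite subr_gt0.
apply: (@le_lt_trans _ _ (M * (1 + (alpha - 2)^-1))%:E); last exact: ltry.
apply: lime_le; first exact: is_cvg_nneseries.
apply: nearW => n.
pose g i := if (0 < i)%N then M * i%:R `^ (1 - alpha) else 0.
have Fg i : (nu (F i) <= (g i)%:E)%E.
  rewrite /F /g; case: ifP => [|_]; first exact: low_V.
  by rewrite setI0 measure0.
have H : (\sum_(0 <= i < n.+1) nu (F i) <= (M * (1 + (alpha - 2)^-1))%:E)%E.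
  apply: (@le_trans _ _ (\sum_(0 <= i < n.+1) (g i)%:E)%E); first exact: lee_sum.
  rewrite sumEFin lee_fin big_ltn // add0r.
  have -> : \sum_(1 <= i < n.+1) g i = M * \sum_(1 <= i < n.+1) i%:R `^ (- (1 + (alpha - 2))).
    rewrite mulr_sumr; apply: eq_big_nat => i /andP[i1 _]; rewrite /g i1.
    by congr (_ * _ `^ _); lra.
  by rewrite ler_wpM2l // sum_powR_le.
apply: le_trans H.
by rewrite big_nat_recr //= leeDl.
Qed.

(** A finite energy would make the potential finite almost everywhere, and then
[S] would be covered, up to a null set, by the null sets of [low_Gdelta]. *)
Lemma energy_Gdelta_infinite : 2 < alpha -> nu (~` S) = 0%E -> real_energy nu = +oo%E.
Proof.
move=> a2 nuS; apply/eqP; rewrite -leye_eq leNgt; apply/negP => fin.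
have mS : measurable S by exact: measurable_uniform_Gdelta.
have intU : nu.-integrable setT U.
  apply/integrableP; split; first exact: measurable_potential.
  rewrite (eq_integral U) // => x _; rewrite gee0_abs //.
have [N [mN N0 HN]] := integrable_ae measurableT intU.
pose B := \bigcup_(n : nat) (low n%:R `&` S).
have mB : measurable B by apply: bigcup_measurable => n _; apply: measurableI.
have nuB : nu B = 0%E.
  apply/eqP; rewrite eq_le measure_ge0 andbT.
  apply: le_trans (generalized_Boole_inequality _ _ _) _ => //.
    by move=> n; apply: measurableI.
  by rewrite eseries0 // => n _ _; apply: low_Gdelta.
have : nu setT = 0%E.
  apply: (@subset_measure0 _ _ _ nu _ ((~` S) `|` N `|` B)) => //.
  - by apply: measurableU => //; apply: measurableU => //; exact: measurableC.
  - move=> x _; have [Sx|] := pselect (S x); last by left; left.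
    have [Nx|nNx] := pselect (N x); first by left; right.
    right; have : U x \is a fin_num.
      by apply: contrapT => h; apply: nNx; apply: HN => /= /(_ I).
    move=> Ufin; exists (Num.truncn (fine (U x))).+1 => //; split=> //=.
    by rewrite /low /= -(fineK Ufin) lee_fin ltW // truncnS_gt.
  have mSN : measurable (~` S `|` N) by apply: measurableU => //; exact: measurableC.
  apply: etrans (@measureU0 _ _ _ nu _ _ mSN mB nuB) _.
  exact: etrans (@measureU0 _ _ _ nu _ _ (measurableC mS) mN N0) nuS.
by rewrite probability_setT => /eqP; rewrite onee_eq0.
Qed.
End ThinGdelta.

(** * Energy of the fractions (2j+1)/(4p) *)

Section Counting.
Context {R : realType}.

(** This is the bound [n! >= (n/e)^n] in logarithmic form. *)
Lemma sum_ln_ratio (n : nat) : (0 < n)%N ->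
  \sum_(1 <= i < n.+1) ln (n%:R / i%:R) <= n%:R :> R.
Proof.
elim: n => // -[_ _|n IH _]; first by rewrite big_nat1 divr1 ln1.
have n0 : 0 < n.+1%:R :> R by rewrite ltr0n.
have n1 : 0 < n.+2%:R :> R by rewrite ltr0n.
rewrite big_nat_recr //= divff ?gt_eqF // ln1 addr0.
have -> : \sum_(1 <= i < n.+2) ln (n.+2%:R / i%:R) =
    \sum_(1 <= i < n.+2) ln (n.+1%:R / i%:R) + \sum_(1 <= i < n.+2) ln (n.+2%:R / n.+1%:R) :> R.
  rewrite -big_split /=; apply: eq_big_nat => i /andP[i0 _].
  have i0' : 0 < i%:R :> R by rewrite ltr0n.
  rewrite -lnM ?posrE ?divr_gt0 //; congr ln; field.
  by rewrite !gt_eqF.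
rewrite -[leRHS]natr1 lerD ?IH // sumr_const_nat subSS subn0.
have -> : n.+2%:R / n.+1%:R = 1 + n.+1%:R^-1 :> R.
  by rewrite -[n.+2%:R]natr1 mulrDl divff ?gt_eqF // mul1r.
rewrite -[leLHS]mulr_natr -ler_pdivlMr // mul1r le_ln1Dx //.
by rewrite (lt_trans (_ : -1 < 0)) ?invr_gt0 // ltrN10.
Qed.

(** Every distance to [l0] is taken at most twice, once on each side. *)
Lemma sum_dist_le (psi : nat -> R) (M l0 : nat) : (l0 < M)%N ->
  (forall i, (0 < i < M)%N -> 0 <= psi i) ->
  \sum_(0 <= l < M | l != l0) psi `|l - l0|%N <= (\sum_(1 <= i < M) psi i) *+ 2.
Proof.
move=> l0M psi0.
have sub k : (0 < k <= M)%N -> \sum_(1 <= i < k) psi i <= \sum_(1 <= i < M) psi i.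
  move=> /andP[k0 kM]; rewrite [leRHS](big_cat_nat _ kM) //= lerDl big_nat_cond.
  apply: sumr_ge0 => i /andP[/andP[ki iM] _]; apply: psi0.
  by rewrite iM andbT (leq_trans k0).
rewrite (big_cat_nat _ (ltnW l0M)) //= mulr2n; apply: lerD.
  rewrite big_mkcond big_nat_rev /=.
  apply: le_trans (sub l0.+1 _); last by rewrite ltnS.
  rewrite big_add1 /= le_eqVlt; apply/orP; left; apply/eqP; apply: eq_big_nat => i /andP[_ il].
  rewrite ifT; last by lia.
  by congr psi; lia.
rewrite big_mkcond big_ltn // eqxx /= add0r.
apply: le_trans (sub (M - l0)%N _); last by lia.
rewrite -[l0.+1]add1n big_addn le_eqVlt; apply/orP; left; apply/eqP; apply: eq_big_nat => i /andP[i0 il].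
rewrite ifT; last by lia.
by congr psi; lia.
Qed.

Lemma ln_le_linear (x : R) : 0 < x -> ln x <= x - 1.
Proof.
by move=> x0; have := @le_ln1Dx R (x - 1); rewrite subrKC; apply; rewrite ltrBrDl subrr.
Qed.

Lemma sum_ln_dist (N l0 : nat) : (l0 < 2 * N)%N ->
  \sum_(0 <= l < 2 * N | l != l0) ln ((8 * N)%:R / `|l - l0|%N%:R) <= 16 * N%:R :> R.
Proof.
move=> l0N; have N0 : (0 < N)%N by lia.
have N0' : 0 < N%:R :> R by rewrite ltr0n.
apply: le_trans (sum_dist_le (fun i => ln ((8 * N)%:R / i%:R)) _ _ l0N _) _.
  move=> i /andP[i0 iN]; rewrite ln_ge0 // ler_pdivlMr ?ltr0n // mul1r ler_nat; lia.
have ln4 : ln 4 <= 3 :> R.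
  by apply: le_trans (ln_le_linear _ _) _ => //; lra.
have : \sum_(1 <= i < 2 * N) ln ((8 * N)%:R / i%:R) <= 8 * N%:R :> R.
  apply: (@le_trans _ _ (\sum_(1 <= i < (2 * N).+1) (ln ((2 * N)%:R / i%:R) + 3))).
    rewrite big_nat_recr /=; last by lia.
    rewrite -[leLHS]addr0; apply: lerD.
      rewrite !big_nat; apply: ler_sum => i /andP[i0 iN].
      have -> : (8 * N)%:R / i%:R = (2 * N)%:R / i%:R * 4 :> R.
        by rewrite (_ : 8 * N = 2 * N * 4)%N ?natrM; [field; rewrite pnatr_eq0; lia|lia].
      by rewrite lnM ?posrE ?divr_gt0 ?ltr0n ?lerD2l //; lia.
    by rewrite divff ?ln1 ?add0r // pnatr_eq0; lia.
  rewrite big_split /= sumr_const_nat.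
  apply: le_trans (lerD (sum_ln_ratio _ _) (lexx _)) _; first by lia.
  rewrite subSS subn0 -mulr_natr !natrM; lra.
by rewrite mulr2n; lra.
Qed.

(** The logarithmic energy of two cells of mesh [1/q] whose indices differ by
[d]; the diagonal value [ln q] is the one for the distance [1/q]. *)
Definition cost (q d : nat) : R := ln (q%:R / (maxn 1 d)%:R).

(** When [4 p] divides [q] this is the numerator of [(2j+1)/(4p)] over the
denominator [q]. The factor [4] puts the fractions with [j < p] into the lower
half of the unit interval, which keeps the descendants of neighbouring cells
apart. *)
Definition site (q p j : nat) : nat := (q %/ (4 * p) * (2 * j + 1))%N.

Lemma site_dist (q p r j l : nat) : (0 < p)%N -> (0 < r)%N ->
  (4 * p %| q)%N -> (4 * r %| q)%N ->
  (4 * p * r * `|site q p j - site q r l| = q * `|(2 * j + 1) * r - (2 * l + 1) * p|)%N.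
Proof.
move=> p0 r0 pq rq; rewrite /site; have := divnK pq; have := divnK rq.
set a := (q %/ (4 * r))%N; set b := (q %/ (4 * p))%N => aq bq.
rewrite -[(4 * p * r)%N]/(`|(4 * p * r)%:Z|)%N -[q]/(`|q%:Z|)%N -!abszM; congr absz.
by rewrite !mulrBr; congr (_ - _); [rewrite -bq|rewrite -aq]; rewrite !PoszM; ring.
Qed.

(** For [m * d = q * w] the distance [d/q] is the fraction [w/m], so the energy
does not see the denominator [q]. *)
Lemma costE (q d w m : nat) : (0 < q)%N -> (0 < m)%N -> (m * d = q * w)%N -> (0 < w)%N ->
  cost q d = ln (m%:R / w%:R).
Proof.
move=> q0 m0 mdqw w0; have d0 : (0 < d)%N by case: d mdqw => //; nia.
rewrite /cost (maxn_idPr d0); congr ln; apply/eqP.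
rewrite eqr_div ?pnatr_eq0; [|lia|lia].
by rewrite -!natrM eqr_nat; apply/eqP; lia.
Qed.

Lemma cost_ge0 q d : (0 < q)%N -> (d <= q)%N -> 0 <= cost q d.
Proof.
move=> q0 dq; rewrite /cost ln_ge0 // ler_pdivlMr ?mul1r ?ler_nat ?ltr0n; lia.
Qed.

(** The quotient [l0] of [x] by [2p] is the index for which [(2 l0 + 1) p] is within
[p] of [x], and every step away from [l0] adds [2p]. *)
Lemma far_from_odd_multiples (x p l : nat) : (0 < p)%N ->
  (p * `|l - x %/ (2 * p)| <= `|x - (2 * l + 1) * p|)%N.
Proof.
move=> p0; have ex : (x %% (2 * p) < 2 * p)%N by rewrite ltn_mod muln_gt0.
rewrite {2}(divn_eq x (2 * p)); move: (x %/ (2 * p))%N (x %% (2 * p))%N ex => l0 e ex.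
by case: (ltngtP l l0) => ll0; nia.
Qed.

(** For fixed [p], [j], [r] the numbers [(2l+1) p] form a progression of step
[2p], so at most one of them, of index [l0], is close to [(2j+1) r]; the others
are treated by [sum_ln_dist]. The index [l0] costs [2 ln (4N)] at most when the
two fractions differ, and [ln q] when they coincide, which is only possible if
[p] divides [(2j+1) r]. *)
Lemma cost_row (N q p j r : nat) : (N <= p < 2 * N)%N -> (N <= r < 2 * N)%N -> (j < N)%N ->
  (0 < q)%N -> (4 * p %| q)%N -> (4 * r %| q)%N ->
  \sum_(0 <= l < N) cost q `|site q p j - site q r l|%N <=
  24 * N%:R + (p %| (2 * j + 1) * r)%N%:R * ln q%:R.
Proof.
move=> /andP[Np pN] /andP[Nr rN] jN q0 pq rq.
have N0 : (0 < N)%N by apply: leq_ltn_trans jN.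
have N0' : 0 < N%:R :> R by rewrite ltr0n.
have p0 : (0 < p)%N by apply: leq_trans Np.
have r0 : (0 < r)%N by apply: leq_trans Nr.
have lnq : 0 <= ln q%:R :> R by rewrite ln_ge0 // ler1n.
pose x := ((2 * j + 1) * r)%N.
pose w l := `|x - (2 * l + 1) * p|%N.
have {pq rq} Hw l : (4 * p * r * `|site q p j - site q r l| = q * w l)%N by exact: site_dist.
pose l0 := (x %/ (2 * p))%N.
have l0N : (l0 < 2 * N)%N by rewrite /l0 ltn_divLR ?muln_gt0 //; apply: ltn_mul; lia.
have far (l : nat) : (p * `|l - l0| <= w l)%N by exact: far_from_odd_multiples.
have pr0 : (0 < 4 * p * r)%N by rewrite !muln_gt0 p0 r0.
have N4 : (0 < 4 * N)%N by rewrite muln_gt0.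
have N8 : (0 < 8 * N)%N by rewrite muln_gt0.
have prN : (4 * p * r <= (4 * N) ^ 2)%N.
  by rewrite -mulnn; move: pN rN; clear; nia.
pose psi (l : nat) : R := ln ((8 * N)%:R / `|l - l0|%N%:R).
pose ex : R := 8 * N%:R + (p %| x)%N%:R * ln q%:R.
have ex0 : 0 <= ex by rewrite addr_ge0 // mulr_ge0.
have psi0 l : (l < 2 * N)%N -> l != l0 -> 0 <= psi l.
  move=> lN ll0; have : (0 < `|l - l0| <= 8 * N)%N by move: (l0) ll0 l0N lN; clear; lia.
  by move=> /andP[d0 d1]; rewrite ln_ge0 // ler_pdivlMr ?mul1r ?ler_nat ?ltr0n.
have key l : cost q `|site q p j - site q r l|%N <= if l != l0 then psi l else ex.
  case: eqVneq => /= [->|ll0].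
    have [w0|w0] := posnP (w l0).
      have -> : `|site q p j - site q r l0|%N = 0%N.
        have /eqP := Hw l0; rewrite w0 muln0 muln_eq0; move/lt0n_neq0/negbTE: pr0 => ->.
        by move/eqP.
      rewrite /cost divr1 /ex (_ : (p %| x)%N) ?mul1r ?lerDr ?mulr_ge0 //.
      have -> : x = ((2 * l0 + 1) * p)%N by move/eqP: w0; rewrite absz_eq0 subr_eq0 => /eqP[].
      exact: dvdn_mull.
    rewrite (costE _ _ _ _ q0 pr0 (Hw l0) w0).
    apply: (@le_trans _ _ (ln ((4 * N)%:R ^+ 2))).
      rewrite ler_ln ?posrE ?divr_gt0 ?exprn_gt0 ?ltr0n //.
      rewrite ler_pdivrMr ?ltr0n // -natrX -natrM ler_nat.
      by apply: leq_trans prN _; exact: leq_pmulr.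
    rewrite lnXn ?ltr0n // natrM.
    have H : ln (4 * N%:R) <= 4 * N%:R - 1 :> R by apply: ln_le_linear; rewrite mulr_gt0.
    rewrite /ex; apply: (@le_trans _ _ (8 * N%:R)); last by rewrite lerDl mulr_ge0.
    by rewrite mulr2n; lra.
  have d0 : (0 < `|l - l0|)%N by move: (l0) ll0; clear; lia.
  have w0 : (0 < w l)%N by apply: leq_trans (far l); rewrite muln_gt0 p0.
  rewrite (costE _ _ _ _ q0 pr0 (Hw l) w0).
  rewrite ler_ln ?posrE ?divr_gt0 ?ltr0n //.
  rewrite ler_pdivrMr ?ltr0n // mulrAC ler_pdivlMr ?ltr0n // -!natrM ler_nat.
  rewrite (_ : 4 * p * r * _ = 4 * r * (p * `|l - l0|))%N; last first.
    by rewrite -!mulnA; congr muln; rewrite mulnCA.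
  by apply: leq_mul (far l); clear -rN; lia.
apply: (@le_trans _ _ (\sum_(0 <= l < 2 * N) if l != l0 then psi l else ex)).
  have N2 : (N <= 2 * N)%N by lia.
  rewrite [leRHS](big_cat_nat (leq0n N) N2) /=.
  rewrite -[leLHS]addr0 lerD ?ler_sum //.
  rewrite big_nat; apply: sumr_ge0 => l /andP[_ lN].
  by case: ifP => // ll0; apply: psi0.
rewrite (bigID (fun l => l != l0)) /=.
rewrite [X in _ + X](_ : _ = ex); last first.
  under eq_bigl do rewrite negbK; rewrite big_mkord.
  by rewrite (big_pred1 (Ordinal l0N)) ?eqxx //= => i.
rewrite [X in X + _](_ : _ = \sum_(0 <= l < 2 * N | l != l0) psi l); last first.
  by apply: eq_bigr => l ->.
by apply: le_trans (lerD (sum_ln_dist _ _ l0N) (lexx _)) _; rewrite /ex; lra.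
Qed.
End Counting.

Section Coincidences.

(** [p %| x * r] means that [p / gcd(p, x)] divides [r]; among the positive
integers up to [2p] there are [2 gcd(p, x)] multiples of this quotient. *)
Lemma count_multiples (N p x : nat) : (0 < p)%N -> (0 < x)%N -> (N <= p)%N ->
  (\sum_(N <= r < 2 * N) (p %| x * r) <= 2 * gcdn p x)%N.
Proof.
move=> p0 x0 Np; have g0 : (0 < gcdn p x)%N by rewrite gcdn_gt0 p0.
have [p' pE] := dvdnP (dvdn_gcdl p x); have [x' xE] := dvdnP (dvdn_gcdr p x).
set g := gcdn p x in g0 pE xE *.
have p'0 : (0 < p')%N by move: p0; rewrite pE muln_gt0 => /andP[].
have cop : coprime p' x'.
  by rewrite /coprime -(eqn_pmul2r g0) mul1n muln_gcdl -pE -xE.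
have dvdE r : (p %| x * r)%N = (p' %| r)%N.
  by rewrite pE xE mulnAC dvdn_pmul2r // Gauss_dvdr.
under eq_bigr do rewrite dvdE.
case: N Np => [|N] Np; first by rewrite big_geq.
apply: (@leq_trans (\sum_(1 <= r < (2 * N.+1).+1) (p' %| r))).
  have N2 : (N.+1 <= (2 * N.+1).+1)%N by lia.
  have N3 : (N.+1 <= 2 * N.+1)%N by lia.
  rewrite [leqRHS](big_cat_nat (ltn0Sn N) N2) /=.
  by rewrite [X in (_ <= _ + X)%N](big_cat_nat N3 (leqnSn _)) /=; lia.
rewrite -divn_count_dvd; apply: leq_trans (leq_div2r p' (_ : _ <= 2 * p)%N) _; first by lia.
by rewrite [in leqLHS]pE mulnCA mulKn.
Qed.

(** The gcd is at most the sum of all common divisors of [p] and [x]; exchanging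
the sums, each [d] is counted once for every pair of its multiples. *)
Lemma sum_gcd (M : nat) :
  (\sum_(1 <= p < M.+1) \sum_(1 <= x < M.+1) gcdn p x <=
   \sum_(1 <= d < M.+1) d * (M %/ d) ^ 2)%N.
Proof.
apply: (@leq_trans (\sum_(1 <= p < M.+1) \sum_(1 <= x < M.+1)
    \sum_(1 <= d < M.+1) d * ((d %| p) * (d %| x)))%N).
  rewrite !big_nat; apply: leq_sum => p /andP[p0 pM].
  rewrite !big_nat; apply: leq_sum => x /andP[x0 xM].
  have g0 : (0 < gcdn p x)%N by rewrite gcdn_gt0 p0.
  have gM : (gcdn p x < M.+1)%N by apply: leq_ltn_trans pM; apply: dvdn_leq => //; exact: dvdn_gcdl.
  rewrite (big_cat_nat g0 (ltnW gM)) /= [X in (_ <= _ + X)%N]big_ltn //.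
  by rewrite dvdn_gcdl dvdn_gcdr !muln1; lia.
under eq_bigr do rewrite exchange_big /=.
rewrite exchange_big /= !big_nat; apply: leq_sum => d /andP[d0 dM].
under eq_bigr => p _ do under eq_bigr => x _ do rewrite mulnA.
under eq_bigr => p _ do rewrite -big_distrr /= -divn_count_dvd.
by rewrite -big_distrl /= -big_distrr /= -divn_count_dvd -mulnA mulnn.
Qed.

Lemma sum_odd (f : nat -> nat) (N : nat) :
  (\sum_(0 <= j < N) f (2 * j + 1) <= \sum_(1 <= x < (2 * N).+1) f x)%N.
Proof.
elim: N => [|N IH]; first by rewrite big_nil.
rewrite big_nat_recr //= (_ : (2 * N.+1).+1 = (2 * N).+3)%N; last by lia.
rewrite (big_nat_recr (2 * N).+2) //= (big_nat_recr (2 * N).+1) //= addn1.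
by rewrite -addnA; apply: leq_add => //; exact: leq_addr.
Qed.

(** The right-hand side is at most [8 N^2] times a harmonic sum: coincidences
have a proportion of order [log N / N^2] among all pairs of fractions. *)
Lemma coincidences (N : nat) :
  (\sum_(N <= p < 2 * N) \sum_(0 <= j < N) \sum_(N <= r < 2 * N) (p %| (2 * j + 1) * r) <=
   2 * \sum_(1 <= d < (2 * N).+1) d * ((2 * N) %/ d) ^ 2)%N.
Proof.
case: (posnP N) => [->|N0]; first by rewrite big_geq.
apply: (@leq_trans (2 * \sum_(1 <= p < (2 * N).+1) \sum_(1 <= x < (2 * N).+1) gcdn p x)%N);
  last by rewrite leq_pmul2l // sum_gcd.
have N2 : (N <= (2 * N).+1)%N by lia.
have N3 : (N <= 2 * N)%N by lia.
rewrite [X in (_ <= 2 * X)%N](big_cat_nat N0 N2) /= mulnDr.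
apply: leq_trans (leq_addl _ _).
rewrite [X in (_ <= 2 * X)%N](big_cat_nat N3 (leqnSn _)) /= mulnDr.
apply: leq_trans (leq_addr _ _).
rewrite big_distrr /= !big_nat; apply: leq_sum => p /andP[Np _].
apply: leq_trans (_ : _ <= 2 * \sum_(0 <= j < N) gcdn p (2 * j + 1))%N _.
  rewrite big_distrr /=; apply: leq_sum => j _.
  by apply: count_multiples => //; lia.
by rewrite leq_pmul2l // (sum_odd (gcdn p)).
Qed.
End Coincidences.

Section LocalEnergy.
Context {R : realType}.

Lemma harmonic_le (n : nat) : (0 < n)%N ->
  \sum_(1 <= d < n.+1) d%:R^-1 <= 1 + ln n%:R :> R.
Proof.
elim: n => // -[_ _|n IH _]; first by rewrite big_nat1 invr1 ln1 addr0.
rewrite big_nat_recr //=; apply: le_trans (lerD (IH isT) (lexx _)) _.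
rewrite -addrA lerD2l -lerBrDl.
have n0 : 0 < n.+1%:R :> R by rewrite ltr0n.
have n1 : 0 < n.+2%:R :> R by rewrite ltr0n.
have -> : ln n.+2%:R - ln n.+1%:R = - ln (n.+1%:R / n.+2%:R) :> R.
  by rewrite ln_div ?posrE // opprB.
rewrite lerNr; apply: le_trans (ln_le_linear _ _) _; first by rewrite divr_gt0.
rewrite le_eqVlt; apply/orP; left; apply/eqP.
move: n0; rewrite -[n.+2%:R]natr1; move: (n.+1%:R) => y y0.
by field; rewrite gt_eqF //; lra.
Qed.

Lemma coincidences_real (N : nat) : (0 < N)%N ->
  (\sum_(N <= p < 2 * N) \sum_(0 <= j < N) \sum_(N <= r < 2 * N) (p %| (2 * j + 1) * r))%:R <=
  8 * N%:R ^+ 2 * (1 + ln (2 * N)%:R) :> R.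
Proof.
move=> N0; apply: (@le_trans _ _ (2 * \sum_(1 <= d < (2 * N).+1) d * ((2 * N) %/ d) ^ 2)%N%:R).
  by rewrite ler_nat coincidences.
rewrite natrM natr_sum.
apply: (@le_trans _ _ (2 * \sum_(1 <= d < (2 * N).+1) (2 * N)%:R ^+ 2 * d%:R^-1)).
  rewrite ler_pM2l // !big_nat; apply: ler_sum => d /andP[d0 dN].
  have d0' : 0 < d%:R :> R by rewrite ltr0n.
  by rewrite ler_pdivlMr // -natrX -!natrM ler_nat; have := leq_trunc_div (2 * N) d; nia.
rewrite -mulr_sumr [in leLHS]natrM exprMn.
have := ler_wpM2l (_ : 0 <= N%:R ^+ 2 :> R) (harmonic_le (2 * N) _).
rewrite exprn_ge0 // muln_gt0 N0 => /(_ isT isT); lra.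
Qed.

(** After division by [N^4] the bound reads [24 + O(log N * ln q / N^2)]: the
first term is the generic energy, the second comes from the coincidences. *)
Lemma local_energy (N q : nat) : (0 < N)%N -> (0 < q)%N ->
  (forall p, (N <= p < 2 * N)%N -> (4 * p %| q)%N) ->
  \sum_(N <= p < 2 * N) \sum_(0 <= j < N) \sum_(N <= r < 2 * N) \sum_(0 <= l < N)
    cost q `|site q p j - site q r l|%N <=
  24 * N%:R ^+ 4 + 8 * N%:R ^+ 2 * (1 + ln (2 * N)%:R) * ln q%:R :> R.
Proof.
move=> N0 q0 qdiv.
have lnq : 0 <= ln q%:R :> R by rewrite ln_ge0 // ler1n.
apply: (@le_trans _ _ (\sum_(N <= p < 2 * N) \sum_(0 <= j < N) \sum_(N <= r < 2 * N)
   (24 * N%:R + (p %| (2 * j + 1) * r)%N%:R * ln q%:R))).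
  rewrite !big_nat; apply: ler_sum => p pN.
  rewrite !big_nat; apply: ler_sum => j /andP[_ jN].
  rewrite !big_nat; apply: ler_sum => r rN.
  exact: cost_row (qdiv _ pN) (qdiv _ rN).
have -> : \sum_(N <= p < 2 * N) \sum_(0 <= j < N) \sum_(N <= r < 2 * N)
      (24 * N%:R + (p %| (2 * j + 1) * r)%N%:R * ln q%:R) =
    24 * N%:R ^+ 4 + (\sum_(N <= p < 2 * N) \sum_(0 <= j < N) \sum_(N <= r < 2 * N)
      (p %| (2 * j + 1) * r))%N%:R * ln q%:R :> R.
  have -> : 24 * N%:R ^+ 4 = \sum_(N <= p < 2 * N) \sum_(0 <= j < N) \sum_(N <= r < 2 * N)
      (24 * N%:R) :> R.
    rewrite !sumr_const_nat subn0 (_ : 2 * N - N = N)%N; last by lia.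
    by rewrite -[X in _ = X]mulr_natr -[X in _ = X * _]mulr_natr -[X in _ = X * _ * _]mulr_natr; ring.
  rewrite natr_sum mulr_suml -big_split; apply: eq_bigr => p _ /=.
  rewrite natr_sum mulr_suml -big_split; apply: eq_bigr => j _ /=.
  by rewrite natr_sum mulr_suml -big_split.
by rewrite lerD2l; apply: ler_wpM2r => //; exact: coincidences_real.
Qed.
End LocalEnergy.

(** * Choice of the refinement parameters *)

Section Growth.
Context {R : realType}.

Lemma ln_le_powR (g x : R) : 0 < g -> 0 < x -> ln x <= g^-1 * x `^ g.
Proof.
move=> g0 x0; rewrite -ler_pdivrMl ?invr_gt0 // invrK -ln_powR.
by rewrite ltW // ln_sublinear // powR_gt0.
Qed.

Lemma powR_unbounded (g A : R) : 0 < g -> exists X0 : nat, forall X : nat, (X0 <= X)%N -> A <= X%:R `^ g.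
Proof.
move=> g0; exists (Num.truncn (`|A| `^ g^-1)).+1 => X X0.
apply: le_trans (ler_norm A) _.
have -> : `|A| = (`|A| `^ g^-1) `^ g by rewrite -powRrM mulVf ?gt_eqF // powRr1.
apply: ge0_ler_powR; rewrite ?nnegrE ?powR_ge0 ?(ltW g0) //.
by apply: ltW; apply: lt_le_trans (truncnS_gt _) _; rewrite ler_nat.
Qed.

(** The growth condition that [alpha < 2] makes possible: the coincidences,
[log X] many per [X^2] pairs, are paid for even though each costs about
[X log X + c X^a]. It will be used with [X = 2N], where [32] is the constant
[8] of [coincidences_real] times the [4] of [X^2 = 4 N^2], and [5] collects the
bounds [ln 4 <= 3] and [ln (2 e^A + 1) <= A + 2]. *)
Lemma subquadratic (a c : R) : a < 2 -> 0 <= c ->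
  exists X0 : nat, forall X : nat, (X0 <= X)%N ->
    32 * (1 + ln X%:R) * (5 + X%:R * ln X%:R + c * X%:R `^ a) <= X%:R ^+ 2 :> R.
Proof.
(* Each logarithm, as well as the constant A, will be bounded by a power x^g. The
   exponent g is such that b = 2 - 2g is at least a and at least 1 + g. *)
move=> a2 c0; pose g := Num.min (1 / 4) ((2 - a) / 2) : R.
have g0 : 0 < g by rewrite lt_min; apply/andP; split; lra.
have g4 : g <= 1 / 4 by rewrite ge_min lexx.
have ga : a + g + g <= 2.
  have : g <= (2 - a) / 2 by rewrite ge_min lexx orbT.
  by lra.
pose A : R := 32 * (1 + g^-1) * (5 + g^-1 + c).
have [X0 HX0] := powR_unbounded _ A g0.
exists X0.+1 => X X0X; have {}HX0 := HX0 X (ltnW X0X).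
have X1 : 1 <= X%:R :> R by rewrite ler1n (leq_trans _ X0X).
have Xp : 0 < X%:R :> R by lra.
have gV : 0 < g^-1 by rewrite invr_gt0.
set x : R := X%:R in HX0 X1 Xp *.
have mono s t : s <= t -> x `^ s <= x `^ t by move=> st; exact: ler_powR.
have one s : 0 <= s -> 1 <= x `^ s by move=> s0; rewrite -(powRr0 x); exact: mono.
have lnx := ln_le_powR _ _ g0 Xp.
have H1 : 1 + ln x <= (1 + g^-1) * x `^ g.
  by rewrite mulrDl mul1r lerD // one // ltW.
pose b := 2 - g - g.
have H2 : 5 + x * ln x + c * x `^ a <= (5 + g^-1 + c) * x `^ b.
  rewrite [leRHS]mulrDl [X in _ <= X + _]mulrDl; apply: lerD; first apply: lerD.
  - by rewrite ler_peMr // one // /b; lra.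
  - apply: (@le_trans _ _ (x * (g^-1 * x `^ g))); first by rewrite ler_wpM2l // ltW.
    rewrite mulrCA ler_pM2l // -{1}(powRr1 (ltW Xp)) -powRD ?(gt_eqF Xp) ?implybT //.
    by apply: mono; rewrite /b; lra.
  - by rewrite ler_wpM2l // mono // /b; lra.
have H3 : x ^+ 2 = x `^ g * (x `^ g * x `^ b).
  rewrite -!powRD ?(gt_eqF Xp) ?implybT // -powR_mulrn ?(ltW Xp) //.
  by congr (_ `^ _); rewrite /b; lra.
have lnx0 : 0 <= ln x by rewrite ln_ge0.
have t0 : 0 <= 5 + x * ln x + c * x `^ a.
  by rewrite !addr_ge0 ?mulr_ge0 ?powR_ge0 // ltW.
rewrite H3 -mulrA; apply: (@le_trans _ _ (32 * ((1 + g^-1) * x `^ g * ((5 + g^-1 + c) * x `^ b)))).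
  by rewrite ler_pM2l // ler_pM // addr_ge0.
have := ler_wpM2r (mulr_ge0 (powR_ge0 x g) (powR_ge0 x b)) HX0.
by rewrite /A; lra.
Qed.

Lemma fact_le_exp n : (n`! <= n ^ n)%N.
Proof.
elim: n => // n IH; rewrite factS expnS leq_mul2l /=.
by apply: leq_trans IH _; case: n => // n; rewrite leq_exp2r.
Qed.

(** The common denominator [q] must be divisible by [4p] for all [p < 2N], which
[(2N)!] ensures at a cost of [N log N] in [ln q], and must exceed
[2 exp((4LN)^a)] so that the new cells fit into the intervals of radius
[r_n / 2] for [n < 4LN]. The bound by [N^2] then makes the energy of the
coincidences at most [1] after averaging. The free lower bound [K] allows the
scale to grow as fast as needed. *)
Lemma choose_parameters (a : R) (L K : nat) : a < 2 -> (0 < L)%N ->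
  exists N q : nat, [/\ (0 < N)%N, (K <= N)%N, (N <= q)%N,
    forall p, (N <= p < 2 * N)%N -> (4 * p %| q)%N &
    8 * (1 + ln (2 * N)%:R) * ln q%:R <= N%:R ^+ 2 :> R /\
    2 * expR ((4 * L * N)%:R `^ a) < q%:R].
Proof.
move=> a2 L0; pose c : R := (2 * L)%:R `^ a.
have [X0 HX] := subquadratic _ c a2 (powR_ge0 _ _).
have [N [N0 KN HN]] : exists N : nat, [/\ (0 < N)%N, (K <= N)%N & (X0 <= 2 * N)%N].
  by exists (X0 + K).+1; split; lia.
move: {HX X0 HN}(HX _ HN).
pose A : R := (4 * L * N)%:R `^ a; have -> : c * (2 * N)%:R `^ a = A.
  by rewrite /c /A -powRM ?ler0n // -natrM; congr (_%:R `^ _); lia.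
have [X XE] : exists X, X = (2 * N)%N by exists (2 * N)%N.
rewrite -XE => HX; have X0 : (0 < X)%N by lia.
have [Q QE] : exists Q, Q = (Num.truncn (2 * expR A)).+1 by eexists.
have Q0 : (0 < Q)%N by rewrite QE.
have Qgt : 2 * expR A < Q%:R by rewrite QE; exact: truncnS_gt.
have [F FE] : exists F, F = X`! by eexists.
have F0 : (0 < F)%N by rewrite FE fact_gt0.
pose q := (4 * F * Q)%N.
have Qq : (Q <= q)%N by rewrite /q leq_pmull // muln_gt0.
have Fq : (F <= q)%N by rewrite /q mulnAC leq_pmull // muln_gt0.
exists N, q; rewrite -/A -?XE; split => //.
- apply: leq_trans Fq; rewrite FE; apply: leq_trans (fact_geq X); lia.
- move=> p /andP[Np pN]; rewrite /q dvdn_mulr // dvdn_pmul2l // FE.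
  by apply: dvdn_fact; lia.
split; last by apply: lt_le_trans Qgt _; rewrite ler_nat.
have lnq : ln q%:R <= 5 + X%:R * ln X%:R + A.
  have A0 : 0 <= A by exact: powR_ge0.
  rewrite /q !natrM !lnM ?posrE ?mulr_gt0 ?ltr0n //.
  have h1 : ln 4 <= 3 :> R by apply: le_trans (ln_le_linear _ _) _ => //; lra.
  have h2 : ln F%:R <= X%:R * ln X%:R :> R.
    apply: (@le_trans _ _ (ln (X%:R ^+ X))).
      by rewrite ler_ln ?posrE ?exprn_gt0 ?ltr0n // -natrX ler_nat FE fact_le_exp.
    by rewrite lnXn ?ltr0n // mulr_natl.
  have h3 : ln Q%:R <= A + 2.
    rewrite -[leRHS]expRK ler_ln ?posrE ?expR_gt0 ?ltr0n //.
    have e1 : 1 <= expR A by rewrite -expR0 ler_expR.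
    have e2 : 3 <= expR 2 :> R by apply: le_trans (expR_ge1Dx 2); lra.
    have : Q%:R <= 2 * expR A + 1.
      by rewrite QE -natr1 lerD2r truncn_le // mulr_ge0 // ltW // expR_gt0.
    rewrite expRD; have := ler_wpM2l (ltW (expR_gt0 A)) e2; lra.
  by lra.
have ln0 : 0 <= 1 + ln X%:R :> R by rewrite addr_ge0 // ln_ge0 // ler1n.
have := ler_wpM2l ln0 lnq; move: HX; rewrite [X in X%:R ^+ 2]XE natrM exprMn; lra.
Qed.

End Growth.

(** * The energy of a refinement *)

Section Refine.
Context {R : realType}.

Definition config_energy (L D : nat) (a : nat -> nat) : R :=
  (\sum_(0 <= i < D) \sum_(0 <= k < D) cost L `|a i - a k|%N) / D%:R ^+ 2.

Lemma sum_divmod (M D : nat) (F : nat -> R) :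
  \sum_(0 <= i < D * M) F i = \sum_(0 <= x < D) \sum_(0 <= y < M) F (x * M + y)%N.
Proof.
elim: D => [|D IH]; first by rewrite mul0n !big_geq.
have DM : (D * M <= D.+1 * M)%N by rewrite leq_mul2r leqnSn orbT.
rewrite big_nat_recr //= -IH (big_cat_nat (leq0n _) DM) /=; congr (_ + _).
rewrite -{1}[(D * M)%N]add0n big_addn mulSn addnK.
by apply: eq_bigr => y _; rewrite addnC.
Qed.

(** The bound that turns an additive loss [1/m] at distance [m] into a relative
loss [1/(1 + ln L)]: both sides agree at [m = 1], where the energy is largest. *)
Lemma slope_ineq (L m : nat) : (0 < m <= L)%N ->
  1 + ln L%:R <= m%:R * (1 + ln (L%:R / m%:R)) :> R.
Proof.
move=> /andP[m0 mL]; have m0' : 0 < m%:R :> R by rewrite ltr0n.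
have m1 : 1 <= m%:R :> R by rewrite ler1n.
have L0 : 0 < L%:R :> R by rewrite ltr0n (leq_trans m0).
have lnmL : ln m%:R <= ln L%:R :> R by rewrite ler_ln ?posrE // ler_nat.
have lnm := ln_le_linear _ m0'.
rewrite ln_div ?posrE //.
have : (m%:R - 1) * ln m%:R <= (m%:R - 1) * ln L%:R :> R by rewrite ler_wpM2l // subr_ge0.
lra.
Qed.

(** Descendants sit in the lower halves of their parents, so at parent distance
[m] their distance is at least [m - 1/2] parent cells. The energy grows by at
most [ln (2m / (2m-1)) <= 1/m], which is relatively small by [slope_ineq]. The
constant [25] is dictated by the case [m = 0], see [sum_offset]. *)
Lemma cost_far (L q m d : nat) : (0 < m <= L)%N -> (0 < q)%N -> (q * (2 * m - 1) <= 2 * d)%N ->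
  cost (L * q) d + 1 <= (1 + 25 / (1 + ln L%:R)) * (cost L m + 1) :> R.
Proof.
move=> /andP[m0 mL] q0 qd.
have m0' : 0 < m%:R :> R by rewrite ltr0n.
have m1 : 1 <= m%:R :> R by rewrite ler1n.
have L0n : (0 < L)%N by exact: leq_trans mL.
have L0 : 0 < L%:R :> R by rewrite ltr0n.
have lnL : 0 <= ln L%:R :> R by rewrite ln_ge0 // ler1n.
have d0 : (0 < d)%N by nia.
have d0' : 0 < d%:R :> R by rewrite ltr0n.
have u0 : 0 < 2 * m%:R - 1 :> R by lra.
rewrite /cost (maxn_idPr d0) (maxn_idPr m0).
have H1 : ln ((L * q)%:R / d%:R) <= ln (L%:R / m%:R) + m%:R^-1 :> R.
  apply: (@le_trans _ _ (ln (L%:R / m%:R * (2 * m%:R / (2 * m%:R - 1))))).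
    rewrite ler_ln ?posrE ?divr_gt0 ?mulr_gt0 ?invr_gt0 ?ltr0n ?muln_gt0 ?q0 ?L0n //.
    rewrite (_ : L%:R / _ * _ = 2 * L%:R / (2 * m%:R - 1)); last by field; rewrite !gt_eqF.
    rewrite ler_pdivrMr // mulrAC ler_pdivlMr // natrM.
    have : q%:R * (2 * m%:R - 1) <= 2 * d%:R :> R.
      move: qd; rewrite -(ler_nat R) !natrM natrB ?natrM //; lia.
    by move=> /(ler_wpM2l (ltW L0)); lra.
  rewrite lnM ?posrE ?divr_gt0 ?mulr_gt0 // lerD2l.
  apply: le_trans (ln_le_linear _ _) _; first by rewrite divr_gt0 ?mulr_gt0.
  rewrite (_ : _ - 1 = (2 * m%:R - 1)^-1); last by field; rewrite gt_eqF.
  by rewrite lef_pV2 ?posrE //; lra.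
have H2 := slope_ineq L m; rewrite m0 mL in H2; have {}H2 := H2 isT.
have H3 : m%:R^-1 <= (1 + ln L%:R)^-1 * (1 + ln (L%:R / m%:R)) :> R.
  rewrite ler_pdivlMl; last by lra.
  by rewrite ler_pdivrMr // mulrC.
have k0 : 0 <= ln (L%:R / m%:R) :> R.
  by rewrite ln_ge0 // ler_pdivlMr // mul1r ler_nat.
have : 0 <= (1 + ln L%:R)^-1 * (1 + ln (L%:R / m%:R)) :> R.
  by rewrite mulr_ge0 ?invr_ge0; lra.
by lra.
Qed.

Lemma cost_scale (L q d : nat) : (0 < L)%N -> (0 < q)%N -> cost (L * q) d = ln L%:R + cost q d :> R.
Proof.
move=> L0 q0; rewrite /cost natrM -mulrA lnM // ?posrE ?divr_gt0 ?ltr0n //; lia.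
Qed.

Lemma site_bounds (q p j : nat) : (0 < q)%N -> (4 * p %| q)%N -> (j < p)%N ->
  (0 < site q p j)%N && (2 * site q p j < q)%N.
Proof.
move=> q0 pq jp; rewrite /site; have := divnK pq; set s := (q %/ (4 * p))%N => sE.
have s0 : (0 < s)%N by case: (s) sE => //; lia.
by rewrite -sE; apply/andP; split; nia.
Qed.

(** The [N^2] pairs [(p, j)] are numbered by [b = (p - N) * N + j]. *)
Definition offset (N q b : nat) : nat := site q (N + b %/ N) (b %% N).
Definition refined (N q : nat) (a : nat -> nat) (i : nat) : nat :=
  (a (i %/ (N * N)) * q + offset N q (i %% (N * N)))%N.

Lemma offset_bounds (N q : nat) : (0 < N)%N -> (0 < q)%N ->
  (forall p, (N <= p < 2 * N)%N -> (4 * p %| q)%N) ->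
  forall b, (b < N * N)%N -> (0 < offset N q b)%N && (2 * offset N q b < q)%N.
Proof.
move=> N0 q0 qdiv b bN; have h1 : (b %/ N < N)%N by rewrite ltn_divLR.
have h2 : (b %% N < N)%N by rewrite ltn_mod.
move: h1 h2; rewrite /offset; move: (b %/ N)%N (b %% N)%N => x y xN yN.
by apply: site_bounds => //; [apply: qdiv; lia|lia].
Qed.

Section Step.
Variables (L D N q : nat) (a : nat -> nat).
Hypotheses (L0 : (0 < L)%N) (D0 : (0 < D)%N) (aL : forall i, (i < D)%N -> (a i < L)%N).
Hypotheses (N0 : (0 < N)%N) (q0 : (0 < q)%N)
  (qdiv : forall p, (N <= p < 2 * N)%N -> (4 * p %| q)%N)
  (Nq : 8 * (1 + ln (2 * N)%:R) * ln q%:R <= N%:R ^+ 2 :> R).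

Local Notation offset := (offset N q).
Local Notation refined := (refined N q a).

(** [24] for the generic pairs and [1] for the coincidences. *)
Lemma sum_offset : \sum_(0 <= b < N * N) \sum_(0 <= c < N * N) cost q `|offset b - offset c|%N
  <= 25 * N%:R ^+ 4 :> R.
Proof.
have dm (x y : nat) : (y < N)%N -> ((x * N + y) %/ N = x)%N /\ ((x * N + y) %% N = y)%N.
  by move=> yN; rewrite divnMDl // divn_small // addn0 modnMDl modn_small.
have shift (F : nat -> R) : \sum_(0 <= x < N) F (N + x)%N = \sum_(N <= p < 2 * N) F p.
  rewrite -[X in _ = \sum_(X <= p < _) _]add0n big_addn (_ : 2 * N - N = N)%N; last by lia.
  by apply: eq_bigr => x _; rewrite addnC.
have -> : \sum_(0 <= b < N * N) \sum_(0 <= c < N * N) cost q `|offset b - offset c|%N =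
   \sum_(N <= p < 2 * N) \sum_(0 <= j < N) \sum_(N <= r < 2 * N) \sum_(0 <= l < N)
    cost q `|site q p j - site q r l|%N :> R.
  rewrite -shift sum_divmod; apply: eq_bigr => x _; rewrite !big_nat.
  apply: eq_bigr => y /andP[_ yN]; rewrite -shift sum_divmod.
  apply: eq_bigr => z _; rewrite !big_nat; apply: eq_bigr => t /andP[_ tN].
  by rewrite /offset; have [-> ->] := dm x y yN; have [-> ->] := dm z t tN.
apply: le_trans (local_energy _ _ N0 q0 qdiv) _.
have := ler_wpM2l (exprn_ge0 2 (ler0n R N)) Nq; lra.
Qed.

(** The energies are compared after adding [1]: a pair of descendants of the same
cell has average energy at most [ln L + 25], that is [1 + 25/(1 + ln L)] times
[ln L + 1] once [1] is added, which is the same relative loss as for distinct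
parents. *)
Lemma refined_energy :
  config_energy (L * q) (D * (N * N)) refined + 1 <=
  (1 + 25 / (1 + ln L%:R)) * (config_energy L D a + 1).
Proof.
set eta : R := 1 + 25 / (1 + ln L%:R).
have lnL : 0 <= ln L%:R :> R by rewrite ln_ge0 // ler1n.
pose M := (N * N)%N; have M0 : (0 < M)%N by rewrite muln_gt0 N0.
have dm (x y : nat) : (y < M)%N -> ((x * M + y) %/ M = x)%N /\ ((x * M + y) %% M = y)%N.
  by move=> yM; rewrite divnMDl // divn_small // addn0 modnMDl modn_small.
have pair i k : (i < D)%N -> (k < D)%N ->
  \sum_(0 <= b < M) \sum_(0 <= c < M)
     (cost (L * q) `|refined (i * M + b) - refined (k * M + c)|%N + 1) <=
  M%:R ^+ 2 * (eta * (cost L `|a i - a k|%N + 1)) :> R.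
  move=> iD kD.
  have refE x y : (y < M)%N -> refined (x * M + y) = (a x * q + offset y)%N.
    by move=> yM; rewrite /refined; have [-> ->] := dm x y yM.
  have [aik|aik] := eqVneq (a i) (a k).
    have -> : `|a i - a k|%N = 0%N by lia.
    apply: (@le_trans _ _ (\sum_(0 <= b < M) \sum_(0 <= c < M)
       (cost q `|offset b - offset c|%N + (ln L%:R + 1)))).
      rewrite !big_nat; apply: ler_sum => b /andP[_ bM].
      rewrite !big_nat; apply: ler_sum => c /andP[_ cM].
      rewrite !refE // aik (_ : `|_ - _|%N = `|offset b - offset c|%N); last by lia.
      by rewrite cost_scale //; lra.
    have -> : \sum_(0 <= b < M) \sum_(0 <= c < M) (cost q `|offset b - offset c|%N + (ln L%:R + 1)) =
      \sum_(0 <= b < M) \sum_(0 <= c < M) cost q `|offset b - offset c|%N + M%:R ^+ 2 * (ln L%:R + 1) :> R.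
      have -> : M%:R ^+ 2 * (ln L%:R + 1) = \sum_(0 <= b < M) \sum_(0 <= c < M) (ln L%:R + 1) :> R.
        by rewrite !sumr_const_nat subn0 -mulrnA -[RHS]mulr_natl natrM expr2.
      by rewrite -big_split; apply: eq_bigr => b _; rewrite -big_split.
    apply: le_trans (lerD sum_offset (lexx _)) _.
    rewrite /cost divr1 (_ : eta * (ln L%:R + 1) = ln L%:R + 1 + 25); last first.
      by rewrite /eta; field; rewrite gt_eqF //; lra.
    by rewrite [leRHS]mulrDr addrC lerD2l /M natrM; lra.
  rewrite (_ : M%:R ^+ 2 * _ = \sum_(0 <= b < M) \sum_(0 <= c < M)
      eta * (cost L `|a i - a k|%N + 1)); last first.
    by rewrite !sumr_const_nat subn0 -mulrnA -[RHS]mulr_natl natrM expr2.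
  rewrite !big_nat; apply: ler_sum => b /andP[_ bM].
  rewrite !big_nat; apply: ler_sum => c /andP[_ cM].
  apply: cost_far => //; first by have := aL i iD; have := aL k kD; lia.
  rewrite !refE //; have := offset_bounds _ _ N0 q0 qdiv b bM; have := offset_bounds _ _ N0 q0 qdiv c cM.
  by case: (ltngtP (a i) (a k)) aik => // h _; nia.
have D0' : 0 < D%:R :> R by rewrite ltr0n.
have M0' : 0 < M%:R :> R by rewrite ltr0n.
have avg L' D' (a' : nat -> nat) : (0 < D')%N -> config_energy L' D' a' + 1 =
   (\sum_(0 <= i < D') \sum_(0 <= k < D') (cost L' `|a' i - a' k|%N + 1)) / D'%:R ^+ 2 :> R.
  move=> D'0; have D'0' : 0 < D'%:R :> R by rewrite ltr0n.
  under eq_bigr => i _ do rewrite big_split /= sumr_const_nat subn0.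
  rewrite big_split /= sumr_const_nat subn0 /config_energy mulrDl; congr (_ + _).
  by rewrite -mulrnA natrM -expr2 divff // gt_eqF // exprn_gt0.
have DM0 : (0 < D * M)%N by rewrite muln_gt0 D0.
rewrite (avg L D a D0) -/M (avg _ _ _ DM0) sum_divmod.
have swap : \sum_(0 <= x < D) \sum_(0 <= y < M) \sum_(0 <= k < D * M)
    (cost (L * q) `|refined (x * M + y) - refined k|%N + 1) =
  \sum_(0 <= x < D) \sum_(0 <= z < D) \sum_(0 <= y < M) \sum_(0 <= t < M)
    (cost (L * q) `|refined (x * M + y) - refined (z * M + t)|%N + 1) :> R.
  apply: eq_bigr => x _; rewrite [RHS]exchange_big_nat /=; apply: eq_bigr => y _.
  by rewrite sum_divmod.
rewrite swap ler_pdivrMr ?exprn_gt0 ?ltr0n //.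
have -> T : eta * (T / D%:R ^+ 2) * (D * M)%:R ^+ 2 = M%:R ^+ 2 * (eta * T).
  by rewrite natrM; field; rewrite gt_eqF.
rewrite !mulr_sumr !big_nat; apply: ler_sum => i /andP[_ iD].
rewrite !mulr_sumr !big_nat; apply: ler_sum => k /andP[_ kD].
exact: pair.
Qed.

End Step.
End Refine.

(** * Infinite refinement *)

(** A multiset of [width] cells [[cell i / scale, (cell i + 1) / scale]]; only the
values of [cell] below [width] are meaningful. *)
Record config := Config { scale : nat; width : nat; cell : nat -> nat }.

Definition valid (c : config) : Prop :=
  [/\ (0 < scale c)%N, (0 < width c)%N & forall i, (i < width c)%N -> (cell c i < scale c)%N].

Section Sequence.
Context {R : realType} (alpha : R).
Hypotheses (alpha0 : 0 < alpha) (alpha2 : alpha < 2).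
Local Notation r := (fun n : nat => expR (- (n%:R `^ alpha)) : R).

Definition energy_of (c : config) : R := config_energy (scale c) (width c) (cell c).

(** By the last clause every point of a new cell lies in some [V n] with
[n >= scale c], as the cell starts in the middle of an interval of [V n] and is
shorter than half of it. Descendants of cell [i] are those of
index [i * M + b] with [b < M], which is what makes the cell of a point readable
from the digits of a single number. *)
Definition refines (c c' : config) : Prop :=
  exists M q : nat, [/\ (0 < M)%N,
    width c' = (width c * M)%N, scale c' = (scale c * q)%N,
    forall i, (i < width c')%N ->
      (cell c (i %/ M) * q <= cell c' i)%N && (cell c' i < (cell c (i %/ M)).+1 * q)%N &
    forall i, (i < width c')%N -> exists n j, [/\ (scale c <= n)%N, (j < n)%N,
      (cell c' i)%:R / (scale c')%:R = midpt j n :> R & (scale c')%:R^-1 < r n / 2]].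

(** The relative energy loss of one refinement, see [refined_energy]. *)
Definition rate (c : config) : R := 25 / (1 + ln (scale c)%:R).

(** The rate is halved by choosing [q] so large that [1 + ln L <= ln q]. *)
Lemma refinement (c : config) : valid c -> exists c', [/\ valid c', refines c c',
  energy_of c' + 1 <= (1 + rate c) * (energy_of c + 1), rate c' <= rate c / 2 &
  (2 * scale c <= scale c')%N].
Proof.
case: c => L D a [/= L0 D0 aL]; rewrite /energy_of /rate /refines /=.
have [N [q [N0 KN Nq qdiv [Hq1 Hq2]]]] :=
  choose_parameters alpha L ((Num.truncn (expR 1 * L%:R : R)).+1 + 2) alpha2 L0.
have q0 : (0 < q)%N by exact: leq_trans Nq.
have M0 : (0 < N * N)%N by rewrite muln_gt0 N0.
have L0' : 0 < L%:R :> R by rewrite ltr0n.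
have q0' : 0 < q%:R :> R by rewrite ltr0n.
have lnL : 0 <= ln L%:R :> R by rewrite ln_ge0 // ler1n.
have off := @offset_bounds N q N0 q0 qdiv.
exists (Config (L * q) (D * (N * N)) (refined N q a)) => /=; split.
- split=> /=; rewrite ?muln_gt0 ?L0 ?q0 ?D0 ?N0 // => i iD.
  have := off (i %% (N * N))%N; rewrite ltn_mod M0 => /(_ isT) /andP[_ h].
  have := aL (i %/ (N * N))%N; rewrite ltn_divLR // => /(_ iD) h2.
  by rewrite /refined; nia.
- exists (N * N)%N, q; split => // i iD.
    have := off (i %% (N * N))%N; rewrite ltn_mod M0 => /(_ isT) /andP[_ h].
    by rewrite /refined; apply/andP; split; nia.
  have := aL (i %/ (N * N))%N; rewrite ltn_divLR // => /(_ iD) aiL.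
  rewrite /refined /offset.
  have h1 : (i %% (N * N) %/ N < N)%N by rewrite ltn_divLR // ltn_mod.
  have h2 : (i %% (N * N) %% N < N)%N by rewrite ltn_mod.
  move: h1 h2 aiL; move: (i %% (N * N) %/ N)%N (i %% (N * N) %% N)%N (a _) => x y z xN yN zL.
  have [p pE] : exists p, p = (N + x)%N by eexists.
  have pN : (N <= p < 2 * N)%N by rewrite pE; lia.
  exists (2 * L * p)%N, (2 * p * z + y)%N; split.
  + by rewrite mulnAC leq_pmull //; lia.
  + by nia.
  + have p0 : 0 < p%:R :> R by rewrite ltr0n; lia.
    have [s qE] := dvdnP (qdiv p pN).
    have s0 : (0 < s)%N by move: q0; rewrite qE muln_gt0 => /andP[].
    have s0' : 0 < s%:R :> R by rewrite ltr0n.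
    rewrite /midpt /site -pE qE mulnK; last by lia.
    rewrite !(natrD, natrM); field.
    by rewrite !gt_eqF.
  + rewrite natrM invfM; apply: (@lt_le_trans _ _ (L%:R^-1 * (2 * expR ((4 * L * N)%:R `^ alpha))^-1)).
      by rewrite ltr_pM2l ?invr_gt0 // ltf_pV2 ?posrE // mulr_gt0 // expR_gt0.
    rewrite invfM -expRN mulrA mulrAC.
    apply: (@le_trans _ _ (expR (- (4 * L * N)%:R `^ alpha) / 2)).
      rewrite ler_pM2r ?invr_gt0 // ler_piMl // ?expR_ge0 // invf_le1 // ler1n //.
    rewrite ler_pM2r ?invr_gt0 // ler_expR lerN2.
    apply: ge0_ler_powR; rewrite ?nnegrE ?(ltW alpha0) // ler_nat; nia.
- exact: (refined_energy L D N q a L0 D0 aL N0 q0 qdiv Hq1).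
- have qL : expR 1 * L%:R <= q%:R :> R.
    apply: ltW; apply: lt_le_trans (truncnS_gt _) _; rewrite ler_nat.
    by apply: leq_trans Nq; apply: leq_trans KN; exact: leq_addr.
  have lnq : 1 + ln L%:R <= ln q%:R :> R.
    rewrite -{1}[1]expRK -lnM ?posrE ?expR_gt0 // ler_ln ?posrE // mulr_gt0 // expR_gt0.
  have h : 2 * (1 + ln L%:R) <= 1 + ln (L * q)%:R :> R.
    by rewrite natrM lnM ?posrE //; lra.
  rewrite -mulrA ler_pM2l // -invfM lef_pV2 ?posrE; lra.
- by rewrite mulnC leq_pmul2l //; lia.
Qed.

(** As rates are halved each time, the quantity [(E + 1) * exp(2 rate)] does not
increase: [1 + rate <= exp(rate)] and [2 rate' <= rate]. *)
Lemma refining_sequence (c0 : config) : valid c0 ->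
  exists c : nat -> config, [/\ c 0%N = c0, forall k, valid (c k),
    forall k, refines (c k) (c k.+1), forall k, (k < scale (c k))%N &
    forall k, energy_of (c k) + 1 <= (energy_of c0 + 1) * expR (2 * rate c0)].
Proof.
move=> c0v.
have /choice[f Hf] : forall c, exists c', valid c -> [/\ valid c', refines c c',
    energy_of c' + 1 <= (1 + rate c) * (energy_of c + 1), rate c' <= rate c / 2 &
    (2 * scale c <= scale c')%N].
  move=> c; have [/refinement[c' H]|nv] := pselect (valid c); first by exists c'.
  by exists c.
pose c k := iter k f c0.
have v k : valid (c k) by elim: k => // k IH; rewrite /c iterS; have [] := Hf _ IH.
have rate0 d : valid d -> 0 <= rate d.
  case=> d0 _ _; rewrite /rate divr_ge0 // addr_ge0 // ln_ge0 // ler1n //.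
have en0 d : valid d -> 0 <= energy_of d.
  case=> d0 w0 cd; rewrite /energy_of /config_energy divr_ge0 ?exprn_ge0 //.
  rewrite big_nat; apply: sumr_ge0 => i /andP[_ iw].
  rewrite big_nat; apply: sumr_ge0 => k /andP[_ kw].
  by apply: cost_ge0 => //; have := cd _ iw; have := cd _ kw; lia.
exists c; split => //.
- by move=> k; have [] := Hf _ (v k).
- elim=> [|k IH]; first by case: (v 0%N).
  have [_ _ _ _ h] := Hf _ (v k); apply: leq_trans h; rewrite -/(c k); lia.
move=> k; suff : (energy_of (c k) + 1) * expR (2 * rate (c k)) <= (energy_of c0 + 1) * expR (2 * rate c0).
  apply: le_trans; rewrite ler_peMr //; first by rewrite addr_ge0 // en0.
  by rewrite -expR0 ler_expR mulr_ge0 // rate0.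
elim: k => [|k IH] //; apply: le_trans IH.
have [_ _ h1 h2 _] := Hf _ (v k); rewrite -/(c k) -/(c k.+1) in h1 h2.
apply: (@le_trans _ _ ((1 + rate (c k)) * (energy_of (c k) + 1) * expR (rate (c k)))).
  apply: ler_pM => //; first by rewrite addr_ge0 // en0.
  by rewrite ler_expR; lra.
have -> : 2 * rate (c k) = rate (c k) + rate (c k) by lra.
rewrite expRD mulrA ler_pM2r ?expR_gt0 // mulrC ler_wpM2l ?expR_ge1Dx //.
by rewrite addr_ge0 // en0.
Qed.

End Sequence.

(** * Random variables with finitely many values *)

Section FiniteIndex.
Context {R : realType} {d : measure_display} {X : measurableType d} (mu : probability X R).
Variables (D : nat) (b : X -> nat).
Hypotheses (bD : forall x, (b x < D)%N)
  (mb : forall i, (i < D)%N -> measurable (b @^-1` [set i])).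

Lemma measurable_finite_index d' (Y : measurableType d') (g : nat -> Y) :
  measurable_fun setT (fun x => g (b x)).
Proof.
move=> _ B mB; rewrite setTI.
have -> : (fun x => g (b x)) @^-1` B =
    \bigcup_(i in [set i | (i < D)%N /\ B (g i)]) (b @^-1` [set i]).
  apply/seteqP; split => x /=; first by move=> Bx; exists (b x).
  by move=> [i [_ Bi] /= ->].
by apply: bigcup_measurable => i [iD _]; exact: mb.
Qed.

Lemma integral_finite_index (g : nat -> R) : (forall i, (i < D)%N -> 0 <= g i) ->
  (\int[mu]_x (g (b x))%:E =
   (\sum_(0 <= i < D) g i * fine (mu (b @^-1` [set i])))%:E)%E.
Proof.
move=> g0.
pose I i := b @^-1` [set i].
pose h (i : nat) (u : X) : \bar R := if (i < D)%N then ((g i)%:E * (\1_(I i) u)%:E)%E else 0%E.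
have mI i : (i < D)%N -> measurable_fun setT (fun u : X => (\1_(I i) u)%:E : \bar R).
  by move=> iD; apply/measurable_EFinP; apply: measurable_indic; exact: mb.
have E u : (g (b u))%:E = (\sum_(0 <= i < D) h i u)%E.
  rewrite (bigD1_seq (b u)) /= ?iota_uniq //; last first.
    by rewrite mem_index_iota bD.
  rewrite big1_seq ?adde0 /h ?bD // => [|i /andP[idu _]].
    by rewrite indicE mem_set // mule1.
  case: ifP => // _; rewrite indicE memNset ?mule0 //.
  by move=> /= e; move: idu; rewrite e eqxx.
rewrite (eq_integral (fun u => \sum_(0 <= i < D) h i u)%E); last by move=> u _; exact: E.
rewrite ge0_integral_sum //.
- rewrite -sumEFin !big_nat; apply: eq_bigr => i /andP[_ iD].
  rewrite /h iD ge0_integralZl_EFin ?g0 //; last exact: mI.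
  rewrite EFinM; congr (_ * _)%E.
  rewrite integral_indic // ?setIT ?fineK //; last exact: mb.
  by apply: fin_num_measure; exact: mb.
- move=> i; have [iD|iD] := boolP (i < D)%N; rewrite /h ?iD ?(negbTE iD) //.
  by apply: emeasurable_funM => //; exact: mI.
- by move=> i u _; rewrite /h; case: ifP => // iD; rewrite mule_ge0 // lee_fin ?g0.
Qed.
End FiniteIndex.

Section Digits.
Context {R : realType}.

(** The identity map, from the type that carries Lebesgue measure to [R] with the
sigma-algebra of [probability R R]. *)
Definition reborel (u : measurableTypeR R) : R := u.

Lemma measurable_reborel : measurable_fun setT reborel.
Proof. by move=> _ Y mY; rewrite setTI. Qed.

HB.instance Definition _ := isMeasurableFun.Build _ _ _ _ _ measurable_reborel.

Definition unit_law : probability R R :=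
  distribution (uniform_prob (@ltr01 R)) (reborel : {mfun measurableTypeR R >-> R}).

(** The value [0] off the half-open unit interval keeps [digit D u < D] true for
all [u], so that [digit D u] always is the index of a cell. *)
Definition digit (D : nat) (u : R) : nat :=
  if 0 <= u < 1 then Num.truncn (D%:R * u) else 0%N.

Lemma digit_lt D u : (0 < D)%N -> (digit D u < D)%N.
Proof.
move=> D0; rewrite /digit; case: ifPn => // /andP[u0 u1].
by rewrite truncn_lt_nat ?mulr_ge0 // gtr_pMr // ltr0n.
Qed.

(** Digits to base [D * M] refine digits to base [D]: this is how one uniform
number follows a cell through all the refinements. *)
Lemma digit_div D M u : (0 < M)%N -> (digit (D * M) u %/ M)%N = digit D u.
Proof.
move=> M0; rewrite /digit; case: ifPn => [/andP[u0 u1]|_]; last exact: div0n.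
have M0' : 0 < M%:R :> R by rewrite ltr0n.
have Du0 : 0 <= D%:R * u by rewrite mulr_ge0.
apply/esym/truncn_def.
set t := Num.truncn ((D * M)%:R * u).
have DMu : 0 <= (D * M)%:R * u by rewrite mulr_ge0.
have [lo hi] := andP (truncn_itv DMu); rewrite -/t in lo hi.
have := divn_eq t M; have := ltn_pmod t M0; set x := (t %/ M)%N; set y := (t %% M)%N => yM tE.
rewrite -(ler_pM2r M0') -(ltr_pM2r M0') mulrAC -!natrM; apply/andP; split.
  by apply: le_trans lo; rewrite ler_nat tE leq_addr.
by apply: lt_le_trans hi _; rewrite ler_nat tE; lia.
Qed.

Let cellset D i : set R := `[i%:R / D%:R, i.+1%:R / D%:R[%classic.

Let digit_pre D i : (i < D)%N -> digit D @^-1` [set i] =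
  if i == 0%N then cellset D i `|` ~` `[0, 1[%classic else cellset D i.
Proof.
move=> iD; have D0 : 0 < D%:R :> R by rewrite ltr0n (leq_ltn_trans _ iD).
have H u : (0 <= u < 1) -> (digit D u = i) <-> cellset D i u.
  move=> u01; rewrite /digit u01 /cellset /= in_itv /=.
  move: u01 => /andP[u0 u1]; rewrite ler_pdivrMr // ltr_pdivlMr // ![u * _]mulrC.
  split=> [<-|/truncn_def//]; by rewrite truncn_itv // mulr_ge0 // ltW.
have sub u : cellset D i u -> 0 <= u < 1.
  rewrite /cellset /= in_itv /= => /andP[lo hi]; apply/andP; split.
    by apply: le_trans lo; rewrite divr_ge0 // ltW.
  by apply: lt_le_trans hi _; rewrite ler_pdivrMr // mul1r ler_nat.
apply/seteqP; split=> u /=.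
  have [u01|u01] := boolP (0 <= u < 1).
    by move/(H _ u01) => ?; case: ifP => // _; left.
  rewrite {1}/digit (negbTE u01) => <-; rewrite eqxx; right.
  by rewrite /= in_itv /= => h; rewrite h in u01.
case: eqVneq => [i0|_]; last by move=> cu; apply/H => //; exact: sub.
move=> [cu|]; first by apply/H => //; exact: sub.
by rewrite /= in_itv /= => /negP/negbTE h; rewrite /digit h.
Qed.

Let measurable_cellset D i : measurable (cellset D i).
Proof. exact: measurable_itv. Qed.

Lemma measurable_digit_pre D i : (i < D)%N -> measurable (digit D @^-1` [set i]).
Proof.
move=> iD; rewrite digit_pre //; case: ifP => // _.
by apply: measurableU => //; apply: measurableC; exact: measurable_itv.
Qed.

Lemma unit_law_itv (x y : R) : 0 <= x -> x < y -> y <= 1 -> unit_law `[x, y[%classic = (y - x)%:E.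
Proof.
move=> x0 xy y1; rewrite /unit_law /= /distribution /pushforward /uniform_prob.
rewrite [X in integral _ X](_ : _ = `[x, y[%classic) // integral_uniform_pdf setIidl; last first.
  by move=> u /=; rewrite !in_itv /= => /andP[xu uy]; lra.
rewrite (eq_integral (cst 1%E)); last first.
  move=> u; rewrite inE /= in_itv /= => /andP[xu uy]; rewrite /uniform_pdf ifT; last by lra.
  by rewrite subr0 invr1.
by rewrite integral_cst //= mul1e lebesgue_measure_itv /= lte_fin xy -EFinD.
Qed.

Lemma unit_law_digit D i : (i < D)%N -> unit_law (digit D @^-1` [set i]) = (D%:R^-1)%:E.
Proof.
move=> iD; have D0n : (0 < D)%N by exact: leq_ltn_trans iD.
have D0 : 0 < D%:R :> R by rewrite ltr0n.
have cE : unit_law (cellset D i) = (D%:R^-1)%:E.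
  rewrite unit_law_itv ?divr_ge0 ?(ltW D0) //.
  - by rewrite -mulrBl -natrB // subSnn mul1r.
  - by rewrite ltr_pM2r ?invr_gt0 // ltr_nat.
  - by rewrite ler_pdivrMr // mul1r ler_nat.
rewrite digit_pre //; case: ifP => // _; rewrite -cE; apply: measureU0 => //.
  by apply: measurableC; exact: measurable_itv.
pose I : set R := `[0, 1[%classic; rewrite -/I.
apply: etrans (probability_setC unit_law (_ : measurable I)) _; first exact: measurable_itv.
by rewrite unit_law_itv // subr0 subee.
Qed.

Lemma measurable_digit_fun d (T : measurableType d) (g : nat -> T) D : (0 < D)%N ->
  measurable_fun setT (fun u => g (digit D u)).
Proof.
move=> D0; apply: (measurable_finite_index D (digit D)) => u; first exact: digit_lt.
exact: measurable_digit_pre.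
Qed.

Lemma integral_digit (g : nat -> R) D : (0 < D)%N -> (forall i, (i < D)%N -> 0 <= g i) ->
  (\int[unit_law]_u (g (digit D u))%:E)%E = ((\sum_(0 <= i < D) g i) / D%:R)%:E.
Proof.
move=> D0 g0; rewrite (integral_finite_index unit_law D) //; last 2 first.
- by move=> u; exact: digit_lt.
- by move=> i; exact: measurable_digit_pre.
congr EFin; rewrite mulr_suml !big_nat; apply: eq_bigr => i /andP[_ iD].
by rewrite unit_law_digit.
Qed.

Lemma integral_digit2 (G : nat -> nat -> R) D : (0 < D)%N ->
  (forall i k, (i < D)%N -> (k < D)%N -> 0 <= G i k) ->
  (\int[unit_law]_u \int[unit_law]_v (G (digit D u) (digit D v))%:E)%E =
  ((\sum_(0 <= i < D) \sum_(0 <= k < D) G i k) / D%:R ^+ 2)%:E.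
Proof.
move=> D0 G0.
rewrite (eq_integral (fun u => ((\sum_(0 <= k < D) G (digit D u) k) / D%:R)%:E)); last first.
  move=> u _; apply: (integral_digit (G (digit D u))) => // k kD; apply: G0 => //.
  exact: digit_lt.
rewrite (integral_digit (fun i => (\sum_(0 <= k < D) G i k) / D%:R)) //.
  by rewrite -mulr_suml expr2 invfM mulrA.
move=> i iD; rewrite divr_ge0 // big_nat sumr_ge0 // => k /andP[_ kD]; exact: G0.
Qed.
End Digits.

(** * The limit measure *)

Section Truncation.
Context {R : realType}.

Lemma log_gauge_anti (d d' : R) : 0 <= d -> d <= d' -> (log_gauge d' <= log_gauge d)%E.
Proof.
move=> d0 dd'; rewrite /log_gauge ge_max le_max lexx /= le_max leeN2; apply/orP; right.
rewrite /lne; case: (ifP (d' <= 0)) => [d'0|/negbT]; first by rewrite ifT ?lexx // (le_trans dd').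
rewrite -ltNge => d'0; case: ifP => [_|/negbT]; first exact: leNye.
by rewrite -ltNge => dp; rewrite lee_fin ler_ln ?posrE.
Qed.

Lemma log_gauge_cvg (dl : nat -> R) (d : R) : 0 <= d -> (forall k, 0 < dl k) ->
  dl @ \oo --> (0 : R) -> log_gauge (d + dl k) @[k --> \oo] --> log_gauge d.
Proof.
move=> d0 dl0 dlc.
have pos (x : R) : 0 < x -> log_gauge x = (Num.max 0 (- ln x))%:E.
  by move=> x0; rewrite /log_gauge /lne ifF ?EFin_max // lt_geF.
under eq_fun => k do rewrite pos ?addr_ge0 ?ltr_wpDl //.
case: (ltgtP 0 d) d0 => // [d0 _|<- _].
  rewrite pos //; apply: cvg_EFin; first exact: nearW.
  pose phi : R -> R := (fun=> 0) \max (fun x => - ln x).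
  have cphi : {for d, continuous phi}.
    apply: continuous_max; first exact: cvg_cst.
    by apply: cvgN; exact: continuous_ln.
  have dc : d + dl k @[k --> \oo] --> d.
    by rewrite -[X in _ --> X]addr0; apply: cvgD => //; exact: cvg_cst.
  exact: (cvg_comp _ _ dc cphi).
have -> : log_gauge (0 : R) = +oo%E by rewrite /log_gauge /lne lexx /= maxey.
apply/cvgeyPge => A.
have : \forall k \near \oo, dl k < expR (- A).
  by apply: (cvgr_lt _ dlc); exact: expR_gt0.
apply: filterS => k dlA; rewrite add0r lee_fin le_max; apply/orP; right.
by rewrite lerNr -ler_expR lnK ?posrE // ltW.
Qed.

(** Adding [dl k] to the distance bounds the kernel, and the shifted kernels
increase to [log_gauge]; monotone convergence is used in both variables. *)
Lemma real_energy_le_of_truncations (nu : probability R R) (dl : nat -> R) (B : \bar R) :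
  (forall k, 0 < dl k) -> {homo dl : n m / (n <= m)%N >-> m <= n} ->
  dl @ \oo --> (0 : R) ->
  (forall k, \int[nu]_x \int[nu]_y log_gauge (`|x - y| + dl k)%R <= B)%E ->
  (real_energy nu <= B)%E.
Proof.
move=> dl0 dlm dlc HB.
pose G k (p : R * R) := log_gauge (`|p.1 - p.2| + dl k).
have mG k : measurable_fun setT (G k).
  apply: (measurableT_comp measurable_log_gauge); apply: measurable_funD => //.
  apply: measurableT_comp => //.
  by apply: measurable_funB; [exact: measurable_fst|exact: measurable_snd].
have G0 k p : (0 <= G k p)%E by exact: log_gauge_ge0.
have Gnd p : {homo (fun k => G k p) : n m / (n <= m)%N >-> (n <= m)%E}.
  by move=> n m nm; apply: log_gauge_anti; rewrite ?lerD2l ?dlm // addr_ge0 // ltW.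
have Glim p : limn (fun k => G k p) = log_gauge (`|p.1 - p.2|).
  by apply/cvg_lim => //; exact: log_gauge_cvg.
pose I k x := (\int[nu]_y G k (x, y))%E.
have mI k : measurable_fun setT (I k).
  exact: (measurable_fun_fubini_tonelli_F (G k)).
have I0 k x : (0 <= I k x)%E by apply: integral_ge0.
have mGx k x : measurable_fun setT (fun y => G k (x, y)) by exact: measurable_fun_section.
have Ind x : {homo (fun k => I k x) : n m / (n <= m)%N >-> (n <= m)%E}.
  by move=> n m nm; apply: ge0_le_integral => // y _; exact: Gnd.
have Ilim x : limn (fun k => I k x) = (\int[nu]_y log_gauge (`|x - y|)%R)%E.
  rewrite -monotone_convergence //.
  by apply: eq_integral => y _; exact: (Glim (x, y)).
have -> : real_energy nu = limn (fun k => \int[nu]_x I k x)%E.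
  rewrite -monotone_convergence //.
  by apply: eq_integral => x _; rewrite Ilim.
apply: lime_le; last by apply: nearW => k; exact: HB.
apply: ereal_nondecreasing_is_cvgn => n m nm.
by apply: ge0_le_integral => // x _; exact: Ind.
Qed.
End Truncation.

Lemma nested_cells (R : realType) (l q x y : nat) : (0 < l)%N -> (0 < q)%N ->
  (x * q <= y)%N -> (y < x.+1 * q)%N ->
  x%:R / l%:R <= y%:R / (l * q)%:R :> R /\
  y%:R / (l * q)%:R + (l * q)%:R^-1 <= x%:R / l%:R + l%:R^-1 :> R.
Proof.
move=> l0 q0 h1 h2.
have l0' : 0 < l%:R :> R by rewrite ltr0n.
have q0' : 0 < q%:R :> R by rewrite ltr0n.
have lq0 : 0 < (l * q)%:R :> R by rewrite natrM mulr_gt0.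
have E (z : R) : z / l%:R = z * q%:R / (l * q)%:R.
  by rewrite natrM; field; rewrite !gt_eqF.
have F (z m : R) : z / m + m^-1 = (z + 1) / m by rewrite mulrDl mul1r.
rewrite !F !E; split; rewrite ler_pM2r ?invr_gt0 // -?natr1.
  by rewrite -natrM ler_nat.
by rewrite !natr1 -natrM ler_nat.
Qed.

Section LimitMeasure.
Context {R : realType} (alpha : R).
Local Notation r := (fun n : nat => expR (- (n%:R `^ alpha)) : R).
Local Notation S := (uniform_Gdelta r).
Variables (c : nat -> config).
Hypotheses (vc : forall k, valid (c k)) (rc : forall k, refines alpha (c k) (c k.+1))
  (kc : forall k, (k < scale (c k))%N).

Let L k := (scale (c k)).
Let D k := (width (c k)).

Let L0 k : (0 < L k)%N. Proof. by case: (vc k). Qed.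
Let D0 k : (0 < D k)%N. Proof. by case: (vc k). Qed.

(* The random point T u is the limit of the left ends T_ k u of the cells picked
   by the digits of u; these cells are nested. *)
Let index k (u : R) := cell (c k) (digit (D k) u).
Let T_ k (u : R) : R := (index k u)%:R / (L k)%:R.
Let dl k : R := (L k)%:R^-1.

Let dl_gt0 k : 0 < dl k. Proof. by rewrite invr_gt0 ltr0n. Qed.

Let T_step k u : T_ k u <= T_ k.+1 u /\ T_ k.+1 u + dl k.+1 <= T_ k u + dl k.
Proof.
have [M [q [M0 DE LE ncell _]]] := rc k.
have Dk : (digit (D k.+1) u < D k.+1)%N by exact: digit_lt.
have /andP[] := ncell _ Dk.
rewrite /T_ /dl /index /D DE digit_div // -/(D k).
set x := cell (c k) _; rewrite -/(D k) in Dk *.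
set y := cell (c k.+1) _ => h1 h2.
rewrite (_ : L k.+1 = (L k * q)%N) //; apply: nested_cells => //.
by have := L0 k.+1; rewrite (_ : L k.+1 = (L k * q)%N) // muln_gt0 => /andP[].
Qed.

Let T_nd u : {homo T_^~ u : n m / (n <= m)%N >-> n <= m}.
Proof. by apply/nondecreasing_seqP => k; case: (T_step k u). Qed.

Let T_ni u : {homo (fun k => T_ k u + dl k) : n m / (n <= m)%N >-> m <= n}.
Proof. by apply/nonincreasing_seqP => k; case: (T_step k u). Qed.

Let T_ub u k n : T_ n u <= T_ k u + dl k.
Proof.
apply: (@le_trans _ _ (T_ (maxn k n) u)); first by apply: T_nd; rewrite leq_maxr.
apply: (@le_trans _ _ (T_ (maxn k n) u + dl (maxn k n))); first by rewrite lerDl ltW.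
by apply: (T_ni u); rewrite leq_maxl.
Qed.

Let T u : R := limn (T_^~ u).

Let T_cvg u : T_^~ u @ \oo --> T u.
Proof.
apply: nondecreasing_is_cvgn => //; exists (T_ 0 u + dl 0) => _ [n _ <-]; exact: T_ub.
Qed.

Let T_bounds u k : T_ k u <= T u <= T_ k u + dl k.
Proof.
apply/andP; split.
  by apply: nondecreasing_cvgn_le => //; exact: T_cvg.
by apply: limr_le; [exact: T_cvg|apply: nearW => n; exact: T_ub].
Qed.

Let measurable_T : measurable_fun setT T.
Proof.
apply: (measurable_fun_cvg (h := T_)) => // k.
exact: (@measurable_digit_fun R _ R (fun i => (cell (c k) i)%:R / (L k)%:R) (D k) (D0 k)).
Qed.

(* The cell of stage m.+1 starts at a midpoint and is shorter than half of the
   interval, so the whole of it, T u included, is in the interval. *)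
Let T_S u : S (T u).
Proof.
apply/in_uniform_Gdelta => m.
have [M [q [M0 DE LE _ ncell]]] := rc m.
have Dk : (digit (D m.+1) u < D m.+1)%N by exact: digit_lt.
have [n [j [Ln jn xE rn]]] := ncell _ Dk.
exists n; first by apply: leq_trans Ln; exact: ltnW.
exists j => //; rewrite /J /= in_itv /= -xE.
have := T_bounds u m.+1; rewrite /T_ /index => /andP[lo hi].
have rp : 0 < dl m.+1 by exact: dl_gt0.
have {}rn : dl m.+1 < r n / 2 by exact: rn.
by apply/andP; split; [apply: lt_le_trans lo|apply: le_lt_trans hi _]; lra.
Qed.

HB.instance Definition _ := isMeasurableFun.Build _ _ _ _ _ measurable_T.

Let nu : probability R R := distribution unit_law (T : {mfun R >-> R}).

Let integral_nu (f : R -> \bar R) : measurable_fun setT f -> (forall x, 0 <= f x)%E ->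
  (\int[nu]_x f x = \int[unit_law]_u f (T u))%E.
Proof. by move=> mf f0; exact: (@ge0_integral_distribution _ _ _ _ _ unit_law (T : {mfun R >-> R})). Qed.

Let dl_cvg : dl @ \oo --> (0 : R).
Proof.
apply: (@squeeze_cvgr _ _ _ _ (fun=> 0) (@harmonic R)).
- apply: nearW => k; rewrite ltW //= lef_pV2 ?posrE ?ltr0n // ler_nat; exact: kc.
- exact: cvg_cst.
- exact: cvg_harmonic.
Qed.

Let dl_ni : {homo dl : n m / (n <= m)%N >-> m <= n}.
Proof.
apply/nonincreasing_seqP => k; rewrite /dl lef_pV2 ?posrE ?ltr0n // ler_nat /L.
have [M [q [_ _ LE _ _]]] := rc k; have := L0 k.+1.
by rewrite /L LE muln_gt0 => /andP[_ q0]; rewrite leq_pmulr.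
Qed.

(* Cells at index distance m >= 2 have points at least (m - 1) / L apart; the
   shift by dl k makes up for the missing 1 / L and covers m = 0 and m = 1. *)
Let dist_lb k u v :
  (maxn 1 `|index k u - index k v|%N)%:R / (L k)%:R <= `|T u - T v| + dl k.
Proof.
have := T_bounds u k; have := T_bounds v k; rewrite /T_ /dl.
have Lk0 : 0 < (L k)%:R :> R by rewrite ltr0n.
move: (T u) (T v) (index k u) (index k v) => s t x y /andP[y1 y2] /andP[x1 x2].
have st := ler_norm (s - t); have ts : t - s <= `|s - t| by rewrite distrC ler_norm.
have pos : 0 <= `|s - t| by [].
have key (p q : nat) : (q <= p)%N -> p%:R / (L k)%:R - q%:R / (L k)%:R <= `|s - t| + (L k)%:R^-1 ->
    (maxn 1 (p - q))%:R / (L k)%:R <= `|s - t| + (L k)%:R^-1.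
  move=> qp h; have [pq|pq] := leqP 1 (p - q)%N; last by rewrite mul1r; lra.
  by rewrite natrB // mulrBl.
have [xy|yx] := leqP x y.
  have -> : `|x - y|%N = (y - x)%N by lia.
  by apply: key => //; lra.
have -> : `|x - y|%N = (x - y)%N by lia.
by apply: key; [exact: ltnW|lra].
Qed.

Let cost_dist k u v :
  (log_gauge (`|T u - T v| + dl k)%R <= (cost (L k) `|index k u - index k v|%N : R)%:E)%E.
Proof.
have Lk0 : 0 < (L k)%:R :> R by rewrite ltr0n.
have cL w : (index k w < L k)%N by have [_ _] := vc k; apply; exact: digit_lt.
set m := `|_|%N; have m0 : 0 < (maxn 1 m)%:R :> R by rewrite ltr0n leq_maxl.
apply: le_trans (log_gauge_anti _ _ _ (dist_lb k u v)) _; first by rewrite divr_ge0 // ltW.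
rewrite /log_gauge /lne ifF; last by rewrite lt_geF // divr_gt0.
rewrite -/m -EFin_max lee_fin ge_max; apply/andP; split.
  by apply: cost_ge0 => //; have := cL u; have := cL v; rewrite /m; lia.
by rewrite /cost -lnV ?posrE ?divr_gt0 // invf_div.
Qed.

(** With the shift [dl k = 1 / L k], the kernel at [(T u, T v)] is at most the
cost of the cells of [u] and [v] at stage [k], whose average over [u] and [v] is
the energy of the configuration. *)
Lemma limit_measure (B : R) : (forall k, energy_of (c k) <= B) ->
  exists2 nu : probability R R, nu (~` S) = 0%E & (real_energy nu <= B%:E)%E.
Proof.
move=> EB; exists nu.
  have TS : T @^-1` (~` S) = set0.
    by apply/seteqP; split => u //= nS; apply: nS; exact: T_S.
  exact: etrans (congr1 unit_law TS) (measure0 _).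
apply: (real_energy_le_of_truncations nu dl) => // k.
apply: le_trans (_ : _ <= (energy_of (c k))%:E)%E _; last by rewrite lee_fin.
have mG : measurable_fun setT (fun p : R * R => log_gauge (`|p.1 - p.2| + dl k)).
  apply: (measurableT_comp measurable_log_gauge); apply: measurable_funD => //.
  apply: measurableT_comp => //.
  by apply: measurable_funB; [exact: measurable_fst|exact: measurable_snd].
have cL i : (i < D k)%N -> (cell (c k) i < L k)%N by have [_ _] := vc k; apply.
rewrite /energy_of /config_energy
  -(integral_digit2 (fun i j => cost (L k) `|cell (c k) i - cell (c k) j|%N) (D k) (D0 k)) //; last first.
  by move=> i j iD jD; apply: cost_ge0 => //; have := cL _ iD; have := cL _ jD; lia.
have mI : measurable_fun setT (fun x : R => (\int[nu]_y log_gauge (`|x - y| + dl k)%R)%E).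
  apply: (measurable_fun_fubini_tonelli_F (fun p : R * R => log_gauge (`|p.1 - p.2| + dl k)) mG) => p.
  exact: log_gauge_ge0.
have mGx x : measurable_fun setT (fun y : R => log_gauge (`|x - y| + dl k)).
  exact: (measurable_fun_section (fun p : R * R => log_gauge (`|p.1 - p.2| + dl k)) x mG).
rewrite (integral_nu _ mI); last first.
  by move=> x; apply: integral_ge0 => y _; exact: log_gauge_ge0.
apply: ge0_le_integral => //=.
- by move=> u _; apply: integral_ge0 => y _; exact: log_gauge_ge0.
- exact: (measurableT_comp mI measurable_T).
- exact: (@measurable_digit_fun R _ _ (fun i => \int[unit_law]_v
     (cost (L k) `|cell (c k) i - cell (c k) (digit (D k) v)|%N)%:E)%E (D k) (D0 k)).
move=> u _; rewrite (integral_nu _ (mGx (T u))); last by move=> y; exact: log_gauge_ge0.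
apply: ge0_le_integral => //=.
- by move=> v _; exact: log_gauge_ge0.
- exact: (measurableT_comp (mGx (T u)) measurable_T).
- exact: (@measurable_digit_fun R _ _ (fun j =>
     (cost (L k) `|cell (c k) (digit (D k) u) - cell (c k) j|%N)%:E) (D k) (D0 k)).
Qed.
End LimitMeasure.

(** * Rounding a measure to a grid *)

Section Discretization.
Context {R : realType}.

(** Points of cells at index distance [m] are at most [(m + 1) / L] apart. The
cost exceeds [ln (L / (m + 1))] by at most [1/m <= 2/(m + 1)], a relatively small
amount by [slope_ineq]. *)
Lemma cost_discretized (L i j : nat) (d : R) : (i < L)%N -> (j < L)%N -> 0 <= d ->
  d <= (`|i - j|.+1)%N%:R / L%:R ->
  ((cost L `|i - j|%N + 1)%:E <= (1 + 2 / (1 + ln L%:R))%:E * (log_gauge d + 1%E))%E.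
Proof.
move=> iL jL d0 dm.
have L0 : (0 < L)%N by exact: leq_ltn_trans iL.
have L0' : 0 < L%:R :> R by rewrite ltr0n.
have lnL : 0 <= ln L%:R :> R by rewrite ln_ge0 // ler1n.
have mL : (`|i - j|.+1 <= L)%N by lia.
move: dm mL; set m := `|i - j|%N => dm mL.
have m1 : 0 < m.+1%:R :> R by rewrite ltr0n.
pose t : R := (1 + ln L%:R)^-1; have t0 : 0 < t by rewrite invr_gt0; lra.
have k0 : 0 <= ln (L%:R / m.+1%:R) :> R.
  by rewrite ln_ge0 // ler_pdivlMr // mul1r ler_nat.
apply: (@le_trans _ _ ((1 + 2 * t)%:E * (ln (L%:R / m.+1%:R) + 1)%:E)%E); last first.
  rewrite lee_pmul2l // ?lte_fin ?fin_numE //; last by rewrite addr_gt0 // mulr_gt0.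
  rewrite EFinD leeD2r //; apply: log_gauge_lb => //.
  by rewrite -lnV ?posrE ?divr_gt0 // invf_div lnK // posrE divr_gt0.
rewrite -EFinM lee_fin /cost.
have [->|m0] := posnP m.
  rewrite maxn0 !divr1 mulrDl mul1r lerDl mulr_ge0 ?addr_ge0 ?mulr_ge0 //; exact: ltW.
rewrite (maxn_idPr m0).
have m0' : 0 < m%:R :> R by rewrite ltr0n.
have H1 : ln (L%:R / m%:R) <= ln (L%:R / m.+1%:R) + m%:R^-1 :> R.
  have -> : L%:R / m%:R = L%:R / m.+1%:R * (m.+1%:R / m%:R) :> R by field; rewrite !gt_eqF.
  rewrite lnM ?posrE ?divr_gt0 // lerD2l; apply: le_trans (ln_le_linear _ _) _.
    by rewrite divr_gt0.
  by rewrite -natr1 mulrDl divff ?gt_eqF // mul1r addrAC subrr add0r.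
have H2 : m.+1%:R^-1 <= t * (1 + ln (L%:R / m.+1%:R)) :> R.
  rewrite /t ler_pdivlMl; last by lra.
  by rewrite ler_pdivrMr // mulrC slope_ineq.
have H3 : m%:R^-1 <= 2 * m.+1%:R^-1 :> R.
  by rewrite -invf_div lef_pV2 ?posrE ?divr_gt0 // ler_pdivrMr // -natrM ler_nat; lia.
move: H1 H2 H3; move: (m%:R^-1) (m.+1%:R^-1) (ln (L%:R / m%:R)) (ln (L%:R / m.+1%:R)) (t).
by move=> u v x y s; lra.
Qed.

(** Real weights are replaced by integer multiplicities [c i], the weights times
[n] rounded to a larger integer. The total multiplicity is at least [n], and the error of the
quadratic form is at most [3 L^2 C / n]. *)
Lemma round_weights (L : nat) (m : nat -> R) (A : nat -> nat -> R) (C eps : R) :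
  (0 < L)%N -> 0 < eps ->
  (forall i, 0 <= m i <= 1) -> \sum_(0 <= i < L) m i = 1 ->
  (forall i j, (i < L)%N -> (j < L)%N -> 0 <= A i j <= C) ->
  exists n : nat, (0 < n)%N /\ exists2 f : nat -> nat, (forall b, (b < n)%N -> (f b < L)%N) &
    (\sum_(0 <= b < n) \sum_(0 <= k < n) A (f b) (f k)) / n%:R ^+ 2 <=
    \sum_(0 <= i < L) \sum_(0 <= j < L) m i * m j * A i j + eps.
Proof.
move=> L0 eps0 m01 m1 A0C.
have C0 : 0 <= C by case/andP: (A0C 0%N 0%N L0 L0) => /le_trans; apply.
pose n := (Num.truncn (3 * L%:R ^+ 2 * C / eps)).+1.
have n0 : 0 < n%:R :> R by rewrite ltr0n.
have nlarge : 3 * L%:R ^+ 2 * C / n%:R <= eps.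
  by rewrite ler_pdivrMr // [leRHS]mulrC -ler_pdivrMr //; apply: ltW; exact: truncnS_gt.
pose c i := (Num.truncn (n%:R * m i)).+1.
have c_lo i : n%:R * m i <= (c i)%:R by apply: ltW; exact: truncnS_gt.
have c_hi i : (c i)%:R <= n%:R * m i + 1.
  rewrite /c -natr1 lerD2r truncn_le mulr_ge0 //; by case/andP: (m01 i).
pose s := flatten [seq nseq (c i) i | i <- index_iota 0 L].
have sumE (g : nat -> R) : \sum_(x <- s) g x = \sum_(0 <= i < L) (c i)%:R * g i.
  rewrite big_flatten big_map; apply: eq_bigr => i _.
  by rewrite big_nseq iter_addr_0 mulr_natl.
have ns : (n <= size s)%N.
  rewrite -(ler_nat R) -sum1_size natr_sum (sumE (fun=> 1)).
  apply: (@le_trans _ _ (\sum_(0 <= i < L) n%:R * m i)).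
    by rewrite -mulr_sumr m1 mulr1.
  apply: ler_sum => i _.
  by rewrite mulr1.
pose f := nth 0%N s.
have fL b : (b < n)%N -> (f b < L)%N.
  move=> bn; have /flattenP[t /mapP[i iL ->]] : f b \in s.
    by apply: mem_nth; exact: leq_trans ns.
  by rewrite mem_nseq => /andP[_ /eqP ->]; move: iL; rewrite mem_index_iota.
have fsum (g : nat -> R) : (forall i, (i < L)%N -> 0 <= g i) ->
    \sum_(0 <= b < n) g (f b) <= \sum_(0 <= i < L) (c i)%:R * g i.
  move=> g0; rewrite -sumE [leRHS](big_nth 0%N) [leRHS](big_cat_nat (leq0n n) ns) /= lerDl.
  rewrite big_nat; apply: sumr_ge0 => b /andP[_ bs]; apply: g0.
  have /flattenP[t /mapP[i iL ->]] : nth 0%N s b \in s by exact: mem_nth.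
  by rewrite mem_nseq => /andP[_ /eqP ->]; move: iL; rewrite mem_index_iota.
exists n; split=> //; exists f => //.
rewrite ler_pdivrMr ?exprn_gt0 //.
have A0 i j : (i < L)%N -> (j < L)%N -> 0 <= A i j.
  by move=> iL jL; case/andP: (A0C _ _ iL jL).
apply: (@le_trans _ _ (\sum_(0 <= b < n) \sum_(0 <= j < L) (c j)%:R * A (f b) j)).
  by rewrite !big_nat; apply: ler_sum => b /andP[_ bn]; apply: fsum => j jL; rewrite A0 // fL.
rewrite exchange_big /=.
apply: (@le_trans _ _ (\sum_(0 <= j < L) \sum_(0 <= i < L) (c i)%:R * ((c j)%:R * A i j))).
  rewrite !big_nat; apply: ler_sum => j /andP[_ jL].
  by apply: (fsum (fun i => (c j)%:R * A i j)) => i iL; rewrite mulr_ge0 // A0.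
rewrite exchange_big /=.
apply: (@le_trans _ _ (\sum_(0 <= i < L) \sum_(0 <= j < L) (n%:R ^+ 2 * (m i * m j * A i j) + 3 * n%:R * C))).
  rewrite !big_nat; apply: ler_sum => i /andP[_ iL].
  rewrite !big_nat; apply: ler_sum => j /andP[_ jL].
  have /andP[mi0 mi1] := m01 i; have /andP[mj0 mj1] := m01 j.
  have /andP[a0 aC] := A0C _ _ iL jL.
  rewrite mulrA.
  have h1 : (c i)%:R * (c j)%:R <= (n%:R * m i + 1) * (n%:R * m j + 1) by apply: ler_pM.
  have n1 : 1 <= n%:R :> R by rewrite ler1n.
  have h2 : (n%:R * m i + 1) * (n%:R * m j + 1) <= n%:R ^+ 2 * (m i * m j) + 3 * n%:R.
    have : n%:R * m i <= n%:R by rewrite ler_piMr.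
    have : n%:R * m j <= n%:R by rewrite ler_piMr.
    lra.
  apply: le_trans (ler_wpM2r a0 (le_trans h1 h2)) _.
  rewrite mulrDl -[X in X + _]mulrA lerD2l; apply: ler_wpM2l => //.
have inner i : \sum_(0 <= j < L) (n%:R ^+ 2 * (m i * m j * A i j) + 3 * n%:R * C) =
    n%:R ^+ 2 * \sum_(0 <= j < L) m i * m j * A i j + L%:R * (3 * n%:R * C).
  by rewrite big_split /= -mulr_sumr sumr_const_nat subn0 [X in _ = _ + X]mulr_natl.
rewrite (eq_bigr _ (fun i _ => inner i)) big_split /= -mulr_sumr sumr_const_nat subn0.
rewrite [leRHS]mulrDl [X in _ <= X + _]mulrC lerD2l -[leLHS]mulr_natl.
have := ler_wpM2r (ltW (exprn_gt0 2 n0)) nlarge; apply: le_trans.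
by rewrite le_eqVlt; apply/orP; left; apply/eqP; field; rewrite gt_eqF.
Qed.
End Discretization.

Section InitialConfig.
Context {R : realType}.

(** The point [1] is put into the last cell, so that all of [[0, 1]] is covered. *)
Definition bin (L : nat) (x : R) : nat := if 1 <= x then L.-1 else digit L x.

Lemma bin_lt L x : (0 < L)%N -> (bin L x < L)%N.
Proof. by move=> L0; rewrite /bin; case: ifP => _; [rewrite prednK|exact: digit_lt]. Qed.

Lemma measurable_bin_pre L i : (i < L)%N -> measurable (bin L @^-1` [set i]).
Proof.
move=> iL.
have -> : bin L @^-1` [set i] = (digit L @^-1` [set i] `&` `]-oo, 1[%classic) `|`
    (if i == L.-1 then `[1, +oo[%classic else set0).
  apply/seteqP; split => x /=; rewrite /bin.
    case: (leP 1 x) => x1 <-; first by right; rewrite eqxx /= in_itv /= x1.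
    by left; split => //; rewrite in_itv.
  case=> [[<-]|]; first by rewrite in_itv /= ltNge => /negbTE ->.
  by case: eqP => // -> ; rewrite /= in_itv /= andbT => ->.
apply: measurableU; last by case: ifP => // _; exact: measurable_itv.
by apply: measurableI; [exact: measurable_digit_pre|exact: measurable_itv].
Qed.

Lemma bin_bounds L (x : R) : (0 < L)%N -> 0 <= x <= 1 ->
  (bin L x)%:R / L%:R <= x <= (bin L x).+1%:R / L%:R.
Proof.
move=> L0 /andP[x0 x1]; have L0' : 0 < L%:R :> R by rewrite ltr0n.
rewrite /bin; case: (leP 1 x) => x1'.
  rewrite prednK // divff ?gt_eqF // x1 andbT.
  by apply: le_trans x1'; rewrite ler_pdivrMr // mul1r ler_nat leq_pred.
rewrite /digit x0 x1' /= ler_pdivrMr // ler_pdivlMr // ![x * _]mulrC.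
have Lx : 0 <= L%:R * x by rewrite mulr_ge0.
by have [-> /ltW ->] := andP (truncn_itv Lx).
Qed.

Lemma bin_dist L (x y : R) : (0 < L)%N -> 0 <= x <= 1 -> 0 <= y <= 1 ->
  `|x - y| <= (`|bin L x - bin L y|.+1)%N%:R / L%:R.
Proof.
move=> L0 /(bin_bounds L _ L0) + /(bin_bounds L _ L0).
move: (bin L x) (bin L y) => i j /andP[x1 x2] /andP[y1 y2].
have L0' : 0 < L%:R :> R by rewrite ltr0n.
have key (p q : nat) : p.+1%:R / L%:R - q%:R / L%:R <= (`|p - q|.+1)%N%:R / L%:R :> R.
  rewrite -mulrBl ler_pM2r ?invr_gt0 // lerBlDr -natrD ler_nat; lia.
rewrite ler_norml; apply/andP; split.
  have := key j i; rewrite distnC; lra.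
by have := key i j; lra.
Qed.

(** Integrating [cost_discretized] over pairs of points bounds the quadratic form
of the masses of the cells, which [round_weights] turns into an average over a
finite list of cells. *)
Lemma initial_config (nu : probability R R) (L : nat) (I eps : R) : (0 < L)%N -> 0 < eps ->
  nu (~` `[0, 1]%classic) = 0%E -> real_energy nu = I%:E ->
  exists c, [/\ valid c, scale c = L &
    energy_of c + 1 <= (1 + 2 / (1 + ln L%:R)) * (I + 1) + eps].
Proof.
move=> L0 eps0 nu01 nuI.
have lnL : 0 <= ln L%:R :> R by rewrite ln_ge0 // ler1n.
pose m i : R := fine (nu (bin L @^-1` [set i])).
pose eta : R := 1 + 2 / (1 + ln L%:R).
have eta0 : 0 < eta by rewrite addr_gt0 // divr_gt0 //; lra.
pose A (i j : nat) : R := cost L `|i - j|%N.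
have A0 i j : (i < L)%N -> (j < L)%N -> 0 <= A i j.
  by move=> iL jL; apply: cost_ge0 => //; lia.
have bL x : (bin L x < L)%N by exact: bin_lt.
have m0 i : 0 <= m i by rewrite fine_ge0.
have msum : \sum_(0 <= i < L) m i = 1.
  have := @integral_finite_index R _ _ nu L (bin L) bL (@measurable_bin_pre L) (fun=> 1) (fun _ _ => ler01).
  rewrite integral_cst // mul1e => total.
  apply: EFin_inj; rewrite -(probability_setT nu); apply: etrans (esym total).
  by congr EFin; apply: eq_bigr => i _; rewrite mul1r.
have inner x : (\int[nu]_y (A (bin L x) (bin L y) + 1)%:E =
    (\sum_(0 <= j < L) (A (bin L x) j + 1) * m j)%:E)%E.
  apply: (integral_finite_index nu L (bin L) bL (@measurable_bin_pre L) (fun j => A (bin L x) j + 1)).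
  by move=> j jL; rewrite addr_ge0 // A0.
have outer : (\int[nu]_x \int[nu]_y (A (bin L x) (bin L y) + 1)%:E =
    (\sum_(0 <= i < L) \sum_(0 <= j < L) m i * m j * A i j + 1)%:E)%E.
  rewrite (eq_integral (fun x => (\sum_(0 <= j < L) (A (bin L x) j + 1) * m j)%:E)); last first.
    by move=> x _; exact: inner.
  rewrite (integral_finite_index nu L (bin L) bL (@measurable_bin_pre L)
    (fun i => \sum_(0 <= j < L) (A i j + 1) * m j)); last first.
    move=> i iL; rewrite big_nat; apply: sumr_ge0 => j /andP[_ jL].
    by rewrite mulr_ge0 // addr_ge0 // A0.
  congr EFin; transitivity (\sum_(0 <= i < L) (\sum_(0 <= j < L) m i * m j * A i j + m i)).
    apply: eq_bigr => i _; rewrite -[X in _ = _ + X]mulr1 -[X in _ = _ + _ * X]msum.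
    rewrite mulr_sumr -big_split /= mulr_suml.
    by apply: eq_bigr => j _; rewrite /m; ring.
  by rewrite big_split /= msum.
pose W x := (\int[nu]_y log_gauge (`|x - y|)%R)%E.
have mW : measurable_fun setT W by exact: measurable_potential.
have W0 x : (0 <= W x)%E by apply: integral_ge0 => y _; exact: log_gauge_ge0.
have mg x : measurable_fun setT (fun y : R => log_gauge (`|x - y|)%R).
  exact: (measurable_fun_section (fun p : R * R => log_gauge (`|p.1 - p.2|)%R) x measurable_log_gauge_dist).
have affine (f : R -> \bar R) : measurable_fun setT f -> (forall x, 0 <= f x)%E ->
    (\int[nu]_x (eta%:E * (f x + 1)) = eta%:E * (\int[nu]_x f x + 1))%E.
  move=> mf f0; rewrite ge0_integralZl_EFin //; last 3 first.
  - by move=> x _; rewrite adde_ge0.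
  - by apply: emeasurable_funD.
  - exact: ltW.
  rewrite ge0_integralD //; congr (_ * (_ + _))%E.
  rewrite integral_cst // mul1e; exact: (probability_setT nu).
have ae01 (P : R -> Prop) : (forall x, 0 <= x <= 1 -> P x) -> {ae nu, forall x, setT x -> P x}.
  move=> HP; exists (~` `[0, 1]%classic); split => //; first exact: measurableC.
  move=> x /= nP; apply: contra_not nP => x01 _; apply: HP.
  by move: x01; rewrite in_itv.
have upper : (\sum_(0 <= i < L) \sum_(0 <= j < L) m i * m j * A i j) + 1 <= eta * (I + 1).
  have -> : eta * (I + 1) = fine (\int[nu]_x (eta%:E * (W x + 1)))%E.
    by rewrite affine // [X in (X + _)%E]nuI.
  rewrite -lee_fin -outer fineK; last by rewrite affine // [X in (X + _)%E]nuI.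
  apply: ae_ge0_le_integral => //.
  - move=> x _; apply: integral_ge0 => y _; rewrite lee_fin addr_ge0 //; exact: A0.
  - under eq_fun do rewrite inner.
    exact: (measurable_finite_index L (bin L) bL (@measurable_bin_pre L) _ _
      (fun i => (\sum_(0 <= j < L) (A i j + 1) * m j)%:E)).
  - by move=> x _; apply: mule_ge0; [rewrite lee_fin ltW|exact: adde_ge0].
  - by apply: measurable_funeM; exact: emeasurable_funD.
  apply: (ae01) => x x01; rewrite -affine //; last by move=> y; exact: log_gauge_ge0.
  apply: ae_ge0_le_integral => //.
  - move=> y _; rewrite lee_fin addr_ge0 //; exact: A0.
  - exact: (measurable_finite_index L (bin L) bL (@measurable_bin_pre L) _ _
      (fun j => (A (bin L x) j + 1)%:E)).
  - by move=> y _; apply: mule_ge0; [rewrite lee_fin ltW|apply: adde_ge0; rewrite ?log_gauge_ge0].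
  - by apply: measurable_funeM; apply: emeasurable_funD => //; exact: mg.
  - by apply: ae01 => y y01; apply: cost_discretized => //; exact: bin_dist.
have [n [n0 [f fL fle]]] : exists n : nat, (0 < n)%N /\ exists2 f : nat -> nat,
    (forall b, (b < n)%N -> (f b < L)%N) &
    (\sum_(0 <= b < n) \sum_(0 <= k < n) A (f b) (f k)) / n%:R ^+ 2 <=
    \sum_(0 <= i < L) \sum_(0 <= j < L) m i * m j * A i j + eps.
  apply: (@round_weights _ L m A (ln L%:R) eps) => // [i|i j iL jL].
    have mi : measurable (bin L @^-1` [set i]).
      have [/measurable_bin_pre//|Li] := ltnP i L.
      rewrite (_ : _ @^-1` _ = set0) //; apply/seteqP; split => // x /= e.
      by have := bL x; rewrite e ltnNge Li.
    by rewrite m0 /= -lee_fin fineK ?probability_le1 // fin_num_measure.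
  rewrite A0 //= /A /cost ler_ln ?posrE ?divr_gt0 ?ltr0n //; try lia.
  rewrite ler_pdivrMr ?ltr0n; last lia.
  by rewrite ler_peMr // ler1n; lia.
exists (Config L n f).
split => //; rewrite /energy_of /config_energy [(1 + _) * _]/(eta * _) /=.
by apply: le_trans (lerD fle (lexx 1)) _; rewrite addrAC lerD2r.
Qed.
End InitialConfig.

(** * Approximation by measures on the G-delta set, and the theorem *)

Section Approximation.
Context {R : realType} (alpha : R).
Hypotheses (alpha0 : 0 < alpha) (alpha2 : alpha < 2).
Local Notation S := (uniform_Gdelta (fun n : nat => expR (- (n%:R `^ alpha)) : R)).

(** The infimum of the energies over [S] is thus no larger than the one over
[[0, 1]]. *)
Lemma energy_approximation (nu : probability R R) (I eps : R) : 0 < eps ->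
  nu (~` `[0, 1]%classic) = 0%E -> real_energy nu = I%:E ->
  exists2 nu' : probability R R, nu' (~` S) = 0%E & (real_energy nu' <= (I + eps)%:E)%E.
Proof.
move=> eps0 nu01 nuI.
have I0 : 0 <= I.
  rewrite -lee_fin -nuI; apply: integral_ge0 => x _; apply: integral_ge0 => y _.
  exact: log_gauge_ge0.
(* With t = 1/(1 + ln L), rounding multiplies energy plus 1 by at most
   1 + 3t <= exp(3t), and refining for ever by exp(2 * 25t); L is chosen with
   53t <= s. *)
pose s := ln ((I + 1 + eps) / (I + 1)).
have s0 : 0 < s by rewrite ln_gt0 // ltr_pdivlMr; lra.
pose L := (Num.truncn (expR (53 / s))).+1.
have L0 : 0 < L%:R :> R by rewrite ltr0n.
have lnL : 53 / s <= ln L%:R.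
  by rewrite -ler_expR lnK ?posrE // ltW // truncnS_gt.
pose t := (1 + ln L%:R)^-1 : R.
have s53 : 0 < 53 / s by rewrite divr_gt0.
have t0 : 0 < t by rewrite invr_gt0; lra.
have ts : 53 * t <= s.
  rewrite -ler_pdivlMr ?invr_gt0; last by lra.
  by rewrite invrK mulrC -ler_pdivrMr //; lra.
have [c0 [vc0 c0L c0E]] := @initial_config R nu L I t isT t0 nu01 nuI.
have [c [c00 vc rc kc cE]] := @refining_sequence R alpha alpha0 alpha2 c0 vc0.
have [nu' nu'S nu'E] := @limit_measure R alpha c vc rc kc
  ((energy_of c0 + 1) * expR (2 * rate c0) - 1) (fun k => ltac:(by rewrite lerBrDr)).
exists nu' => //; apply: le_trans nu'E _; rewrite lee_fin lerBlDr.
have -> : 2 * rate c0 = 50 * t :> R by rewrite /rate c0L -/t; lra.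
have step : energy_of c0 + 1 <= (I + 1) * (1 + 3 * t) by apply: le_trans c0E _; rewrite -/t; nra.
apply: le_trans (_ : (I + 1) * expR (53 * t) <= _).
  rewrite (_ : 53 * t = 3 * t + 50 * t) ?expRD ?mulrA; last by ring.
  rewrite ler_pM2r ?expR_gt0 //; apply: le_trans step _; rewrite ler_pM2l ?expR_ge1Dx //; lra.
rewrite -ler_pdivlMl; last by lra.
have es : expR s = (I + 1)^-1 * (I + eps + 1).
  by rewrite mulrC [in RHS]addrAC lnK // posrE divr_gt0 //; lra.
by rewrite -es ler_expR.
Qed.
End Approximation.

Theorem theorem1p2 (R : realType) (alpha : R) (halpha : 0 < alpha) :
  let S := uniform_Gdelta (fun n : nat => expR (- (n%:R `^ alpha))) in
  (2 < alpha -> Cap (in_plane S) = 0%E) /\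
  (alpha < 2 -> Cap (in_plane S) = Cap (in_plane `[0, 1])).
Proof.
move=> S.
have mS : measurable S by exact: measurable_uniform_Gdelta.
have S01 : S `<=` `[0, 1]%classic by exact: uniform_Gdelta_sub01.
rewrite /Cap (energies_in_plane S) // (energies_in_plane `[0, 1]%classic) //.
split=> [alpha2|alpha2].
  rewrite (_ : ereal_inf _ = +oo%E) //; apply/ereal_inf_pinfty => _ [nu nuS <-].
  exact: (energy_Gdelta_infinite alpha).
congr (expeR (- _)%E); apply/eqP; rewrite eq_le; apply/andP; split; last first.
  apply: ereal_inf_le_tmp => _ [nu nuS <-]; exists nu => //.
  apply: (subset_measure0 _ _ _ nuS) => //.
  - by apply: measurableC.
  - by apply: measurableC.
  - exact: subsetC.
apply: le_ereal_inf_tmp => _ [nu nu01 <-].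
case E : (real_energy nu) => [I| |]; last first.
- have : (0 <= real_energy nu)%E.
    by apply: integral_ge0 => x _; apply: integral_ge0 => y _; exact: log_gauge_ge0.
  by rewrite E.
- exact: leey.
apply/lee_addgt0Pr => eps eps0.
have [nu' nu'S nu'E] := energy_approximation alpha halpha alpha2 nu I eps eps0 nu01 E.
by apply: le_trans nu'E; apply: ereal_inf_lbound; exists nu'.
Qed.
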